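(* Let $K\ge 1$, $N\ge 2K$ and $L\in\mathbb{N}$ with $K\le L\le N-K$. Let $z_1,\dots,z_K\in\mathbb{C}$ be non-zero, pairwise distinct nodes in the closed unit disk ($0<|z_k|\le 1$), let $\alpha_1,\dots,\alpha_K\in\mathbb{C}$ be weights with $\alpha_{\min}\triangleq\min_k|\alpha_k|>0$, and put $\alpha_{\max}\triangleq\max_k|\alpha_k|$. Let $\boldsymbol e=(e_0,\dots,e_{N-1})\in\mathbb{C}^N$ be an arbitrary (deterministic) noise vector, and let the measurements be $\widetilde x_n=x_n+e_n$, $n=0,\dots,N-1$, where $x_n=\sum_{k=1}^K\alpha_k z_k^n$. \textbf{Case 1 (ESPRIT).} Let $\widetilde{\mathbf X}=\mathscr H_L(\widetilde x_0,\dots,\widetilde x_{N-1})\in\mathbb{C}^{L\times(N-L+1)}$, and let $\widetilde{\mathbf S}\in\mathbb{C}^{L\times K}$ be the matrix whose columns are the left singular vectors of $\widetilde{\mathbf X}$ associated with its $K$ largest singular values in a singular value decomposition of $\widetilde{\mathbf X}$. Let $\widetilde{\mathbf S}_\downarrow$ (resp. $\widetilde{\mathbf S}_\uparrow$) be the $(L-1)\times K$ matrix formed by the first (resp. last) $L-1$ rows of $\widetilde{\mathbf S}$, let $\widetilde{\boldsymbol\Phi}=\widetilde{\mathbf S}_\downarrow^\dagger\widetilde{\mathbf S}_\uparrow\in\mathbb{C}^{K\times K}$ ($\dagger$ the Moore–Penrose pseudoinverse), and let $\widehat z_1,\dots,\widehat z_K$ be the eigenvalues of $\widetilde{\boldsymbol\Phi}$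 (with algebraic multiplicity). Assume that $\widetilde{\boldsymbol\Phi}$ is a solution of the linear system $\widetilde{\mathbf S}_\downarrow\mathbf Y=\widetilde{\mathbf S}_\uparrow$, and that \[\gamma\triangleq\frac{\sqrt{\min\{L,N-L+1\}}\,\|\boldsymbol e\|_2}{\alpha_{\min}\,\sigma_{\min}(\mathbf V_L)\,\sigma_{\min}(\mathbf V_{N-L+1})}<\frac{1}{1+\sqrt2\,\beta},\qquad \beta\triangleq\frac{\sigma_{\max}(\mathbf V_L)}{\sigma_{\min}(\mathbf V_{L-1})}.\] Then there is a permutation $\pi$ of $\{1,\dots,K\}$ such that for all $k=1,\dots,K$, \[|\widehat z_{\pi(k)}-z_k|\le\frac{(2K-1)\sqrt2\,\beta\gamma}{1-(1+\sqrt2\beta)\gamma}\bigl(1+\kappa(\mathbf V_L)\bigr)\kappa(\mathbf V_L).\] \textbf{Case 2 (Matrix Pencil).} Let $\widetilde{\mathbf X}_1=\mathscr H_L(\widetilde x_0,\dots,\widetilde x_{N-2})$ and $\widetilde{\mathbf X}_2=\mathscr H_L(\widetilde x_1,\dots,\widetilde x_{N-1})$, both in $\mathbb{C}^{L\times(N-L)}$. Take a singular value decomposition of $\widetilde{\mathbf X}_1$ and let $\widetilde{\mathbf S}_1\in\mathbb{C}^{L\times K}$ and $\widetilde{\mathbf R}_1\in\mathbb{C}^{(N-L)\times K}$ consist of the left, resp. right, singular vectors associated with the $K$ largest singular values of $\widetilde{\mathbf X}_1$. Define $\widetilde{\boldsymbol\Psi}_1=\widetilde{\mathbf S}_1^H\widetilde{\mathbf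 X}_1\widetilde{\mathbf R}_1$ and $\widetilde{\boldsymbol\Psi}_2=\widetilde{\mathbf S}_1^H\widetilde{\mathbf X}_2\widetilde{\mathbf R}_1$ in $\mathbb{C}^{K\times K}$. Assume the pair $(\widetilde{\boldsymbol\Psi}_1,\widetilde{\boldsymbol\Psi}_2)$ is regular, and let $\widehat z_1,\dots,\widehat z_K\in\mathbb{C}\cup\{\infty\}$ be its $K$ generalized eigenvalues (with algebraic multiplicity, including infinite ones). Assume \[\gamma\triangleq\frac{\sqrt{\min\{L,N-L\}}\,\|\boldsymbol e\|_2}{\alpha_{\min}\,\sigma_{\min}(\mathbf V_L)\,\sigma_{\min}(\mathbf V_{N-L})}<1.\] Then there is a permutation $\pi$ of $\{1,\dots,K\}$ such that for all $k=1,\dots,K$, \[\chi(\widehat z_{\pi(k)},z_k)\le\frac{(2K-1)\gamma}{\sqrt{1+A_{\min}^2}}\left[\frac{2\sqrt2}{1-\gamma}\frac{\alpha_{\max}}{\alpha_{\min}}\kappa(\mathbf V_L)\kappa(\mathbf V_{N-L})+\left(1+\frac{\sqrt2\gamma}{1-\gamma}\right)\right],\] where $A_{\min}\triangleq\min_{1\le k\le K}|z_k|$.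
   Context: For $M\ge K$, $\mathbf V_M\in\mathbb{C}^{M\times K}$ denotes the Vandermonde matrix with entries $(\mathbf V_M)_{\ell k}=z_k^{\ell-1}$, $\ell=1,\dots,M$, $k=1,\dots,K$. For complex numbers $y_0,\dots,y_{M-1}$ and $1\le L\le M$, $\mathscr H_L(y_0,\dots,y_{M-1})\in\mathbb{C}^{L\times(M-L+1)}$ is the Hankel matrix with $(i,j)$ entry $y_{i+j}$ ($0\le i\le L-1$, $0\le j\le M-L$). $\sigma_{\min},\sigma_{\max}$ denote the smallest and largest singular values, $\kappa(\mathbf A)=\sigma_{\max}(\mathbf A)/\sigma_{\min}(\mathbf A)$. A pair $(\mathbf A,\mathbf B)$ of $K\times K$ matrices is regular if there is $(a,b)\in\mathbb{C}^2$ with $\det(a\mathbf A-b\mathbf B)\neq0$; its generalized eigenvalues are the $\lambda\in\mathbb{C}$ such that $\mathbf B\boldsymbol y=\lambda\mathbf A\boldsymbol y$ for some $\boldsymbol y\ne0$, i.e. roots of $\det(\mathbf B-\lambda\mathbf A)$, with the value $\infty$ assigned (with multiplicity) to the missing roots, corresponding to vectors $\boldsymbol y\neq 0$ with $\mathbf A\boldsymbol y=0$; a regular pair has exactly $K$ generalized eigenvalues in $\mathbb{C}\cup\{\infty\}$ counted with algebraic multiplicity. The chordal distance on $\mathbb{C}\cup\{\infty\}$ is $\chi(z,z')=|z-z'|/(\sqrt{1+|z|^2}\sqrt{1+|z'|^2})$ for $z,z'\in\mathbb{C}$ and $\chi(z,\infty)=1/\sqrt{1+|z|^2}$ for $z\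in\mathbb{C}$.
   Formalization: Case 1 (ESPRIT) is stated only for L ≥ K+1: for L = K the matrix V_{L-1} in β is undefined (M ≥ K is required), and reading it as a (K-1)×K matrix makes the claim false, e.g. e = 0, where the matrix Φ is singular but all nodes are non-zero. *)

(* Defs.v *)
From HB Require Import structures.
From mathcomp Require Import all_boot all_order all_algebra.
From mathcomp Require Import complex perm.
From Stdlib Require Import ClassicalEpsilon.
Set Implicit Arguments. Unset Strict Implicit. Unset Printing Implicit Defensive.
Import Order.TTheory GRing.Theory Num.Theory Num.Def.
Local Open Scope ring_scope.

Section Defs.
Variable R : rcfType.
Local Notation C := R[i].

Definition cabs (z : C) : R := ComplexField.Normc.normc z.

Definition ctr m n (A : 'M[C]_(m, n)) : 'M[C]_(n, m) := (map_mx (@conjc R) A)^T.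

Definition orthonormal_cols m n (U : 'M[C]_(m, n)) : Prop := ctr U *m U = 1%:M.

Definition diagR m n (s : nat -> R) : 'M[C]_(m, n) :=
  \matrix_(i, j) (if (i : nat) == j then (s i)%:C%C else 0).

Definition is_svd m n (A : 'M[C]_(m, n)) (U : 'M[C]_m) (s : nat -> R) (V : 'M[C]_n) : Prop :=
  [/\ orthonormal_cols U /\ orthonormal_cols V,
      (forall i j, (i <= j)%N -> (j < minn m n)%N -> s j <= s i),
      (forall i, (i < minn m n)%N -> 0 <= s i),
      (forall i, (minn m n <= i)%N -> s i = 0) &
      A = U *m diagR m n s *m ctr V].

Definition singval m n (A : 'M[C]_(m, n)) (i : nat) : R :=
  epsilon (inhabits 0) (fun x => exists U s V, is_svd A U s V /\ s i = x).

Definition sigma_max m n (A : 'M[C]_(m, n)) : R := singval A 0.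
Definition sigma_min m n (A : 'M[C]_(m, n)) : R := singval A (minn m n).-1.
Definition kappa m n (A : 'M[C]_(m, n)) : R := sigma_max A / sigma_min A.

Definition is_pinv m n (A : 'M[C]_(m, n)) (P : 'M[C]_(n, m)) : Prop :=
  [/\ A *m P *m A = A, P *m A *m P = P, ctr (A *m P) = A *m P & ctr (P *m A) = P *m A].
Definition pinv m n (A : 'M[C]_(m, n)) : 'M[C]_(n, m) :=
  epsilon (inhabits 0) (fun P => is_pinv A P).

Definition vander K (z : 'I_K -> C) (M : nat) : 'M[C]_(M, K) :=
  \matrix_(l, k) (z k) ^+ l.

Definition hankel (L M : nat) (y : nat -> C) : 'M[C]_(L, (M - L).+1) :=
  \matrix_(i, j) y (i + j)%N.

Definition rowsel m n p (A : 'M[C]_(m, n)) (f : nat -> nat) : 'M[C]_(p, n) :=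
  \matrix_(i, j) \sum_(l < m | (l : nat) == f i) A l j.
Definition firstcols m n k (A : 'M[C]_(m, n)) : 'M[C]_(m, k) :=
  \matrix_(i, j) \sum_(l < n | (l : nat) == j) A i l.

Definition vnorm (N : nat) (e : nat -> C) : R :=
  Num.sqrt (\sum_(n < N) cabs (e n) ^+ 2).

(* min / max over a finite family (correct for n >= 1) *)
Definition fmin n (f : 'I_n -> R) : R :=
  \big[minr/ (\big[maxr/0]_i f i)]_i f i.
Definition fmax n (f : 'I_n -> R) : R :=
  \big[maxr/ (\big[minr/0]_i f i)]_i f i.

Definition eigvals_mult K (A : 'M[C]_K) (zh : 'I_K -> C) : Prop :=
  char_poly A = \prod_(k < K) ('X - (zh k)%:P).

Definition regular_pair K (A B : 'M[C]_K) : Prop :=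
  exists a b : C, \det (a *: A - b *: B) != 0.

Definition pencil_poly K (A B : 'M[C]_K) : {poly C} :=
  \det (map_mx polyC B - 'X *: map_mx polyC A).

(* generalized eigenvalues in C u {oo} (None = oo) with algebraic multiplicity:
   the finite ones are the roots of det(B - lambda A) with multiplicity, and
   oo gets the remaining K - deg det(B - lambda A) *)
Definition gen_eigvals_mult K (A B : 'M[C]_K) (zh : 'I_K -> option C) : Prop :=
  exists c : C, c != 0 /\
    pencil_poly A B = c *: \prod_(k < K) (if zh k is Some w then 'X - w%:P else 1).

Definition chordal (z' : option C) (z : C) : R :=
  match z' with
  | Some w => cabs (w - z) / (Num.sqrt (1 + cabs w ^+ 2) * Num.sqrt (1 + cabs z ^+ 2))
  | None => 1 / Num.sqrt (1 + cabs z ^+ 2)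
  end.

End Defs.

(* Main.v *)
Require Import Defs.
From mathcomp Require Import all_boot all_order all_algebra.
From mathcomp Require Import complex perm spectral.
From mathcomp Require Import ring lra zify.
From Stdlib Require Import ClassicalEpsilon.

(** Write the exact Hankel matrix as [V_L D V_Q^T], with [V_L] and [V_Q] Vandermonde and [D] the
    diagonal matrix of the weights; a Hankel noise matrix has Frobenius norm at most
    [sqrt (min(L, Q)) * |e|].  Weyl's inequality keeps the K-th singular value of the noisy matrix
    away from 0, so its dominant singular vectors span a subspace whose sine of angle to the range of
    [V_L] (resp. of the conjugate of [V_Q]) is at most [gamma / (1 - gamma)].
    ESPRIT: a polar decomposition aligns the noisy basis with an exact one up to [sqrt 2] times this
    sine, whence the shift matrix, in the basis where it is diagonal, is perturbed by a small matrix.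
    Matrix pencil: dividing the compressed pencil by the compressed Vandermonde factors and by [D]
    turns it into a small perturbation of the pencil [(1, diag z)]; when gamma is not small the claimed
    bound exceeds 1, which dominates every chordal distance.
    Both cases end with Sun's theorem: the eigenvalues of a perturbation F of a normal K x K matrix
    match the original ones up to [K * |F| <= (2 K - 1) * |F|]. *)

Set Implicit Arguments.
Unset Strict Implicit.
Unset Printing Implicit Defensive.
Import Order.TTheory GRing.Theory Num.Theory.
Import ComplexField.Normc.
Local Notation Re := complex.Re.
Local Open Scope ring_scope.

Section Norms.
Variable R : rcfType.
Local Notation C := R[i].
Implicit Types (z w : C).

Lemma cabs_ge0 z : 0 <= cabs z.
Proof. by case: z => a b; rewrite sqrtr_ge0. Qed.

Lemma cabsE z : (cabs z)%:C%C = `|z|.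
Proof. by []. Qed.

Lemma cabs_sqr z : cabs z ^+ 2 = Re (conjc z * z).
Proof.
case: z => a b; rewrite /cabs /= sqr_sqrtr; last by rewrite addr_ge0 ?sqr_ge0.
by rewrite mulNr opprK !expr2.
Qed.

Lemma cabs_sqrC z : (cabs z ^+ 2)%:C%C = conjc z * z.
Proof. by rewrite rmorphXn /= cabsE sqr_normc mulrC. Qed.

Lemma cabsM z w : cabs (z * w) = cabs z * cabs w.
Proof. exact: normcM. Qed.

Lemma cabs0 : cabs (0 : C) = 0.
Proof. exact: normc0. Qed.

Lemma cabs1 : cabs (1 : C) = 1.
Proof. exact: normc1. Qed.

Lemma cabsN z : cabs (- z) = cabs z.
Proof. exact: normcN. Qed.

Lemma cabs_eq0 z : (cabs z == 0) = (z == 0).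
Proof.
by apply/eqP/eqP => [/eq0_normc //|->]; rewrite cabs0.
Qed.

Lemma cabs_conj z : cabs (conjc z) = cabs z.
Proof. by case: z => a b; rewrite /cabs /= sqrrN. Qed.

Lemma cabs_real (a : R) : cabs (a%:C%C) = `|a|.
Proof. by rewrite /cabs /= expr0n addr0 sqrtr_sqr. Qed.

Lemma ler_cabsD z w : cabs (z + w) <= cabs z + cabs w.
Proof. exact: le_normcD. Qed.

Lemma Re_le_cabs z : Re z <= cabs z.
Proof.
case: z => a b; rewrite /cabs /=; apply: le_trans (ler_norm a) _.
by rewrite -sqrtr_sqr ler_sqrt ?lerDl ?addr_ge0 ?sqr_ge0.
Qed.

Lemma ReM_real (a : R) z : Re (a%:C%C * z) = a * Re z.
Proof. by case: z => x y; rewrite /= mul0r subr0. Qed.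

Lemma ctrE m n (A : 'M[C]_(m, n)) i j : ctr A i j = conjc (A j i).
Proof. by rewrite !mxE. Qed.

Lemma ctrK m n (A : 'M[C]_(m, n)) : ctr (ctr A) = A.
Proof. by apply/matrixP => i j; rewrite !ctrE conjcK. Qed.

Lemma ctrM m n p (A : 'M[C]_(m, n)) (B : 'M[C]_(n, p)) :
  ctr (A *m B) = ctr B *m ctr A.
Proof. by rewrite /ctr map_mxM trmx_mul. Qed.

Lemma ctrD m n (A B : 'M[C]_(m, n)) : ctr (A + B) = ctr A + ctr B.
Proof. by rewrite /ctr map_mxD linearD. Qed.

Lemma ctr1 n : ctr (1%:M : 'M[C]_n) = 1%:M.
Proof. by rewrite /ctr map_mx1 trmx1. Qed.

Lemma ctrZ m n c (A : 'M[C]_(m, n)) : ctr (c *: A) = conjc c *: ctr A.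
Proof. by apply/matrixP => i j; rewrite !mxE rmorphM. Qed.

Lemma ctr0 m n : ctr (0 : 'M[C]_(m, n)) = 0.
Proof. by apply/matrixP => i j; rewrite !mxE conjc0. Qed.

Lemma mxtrace_ctr n (A : 'M[C]_n) : \tr (ctr A) = conjc (\tr A).
Proof. by rewrite /mxtrace rmorph_sum; apply: eq_bigr => i _; rewrite ctrE. Qed.

Definition nrm2 m n (A : 'M[C]_(m, n)) : R := \sum_i \sum_j cabs (A i j) ^+ 2.
Definition nrm m n (A : 'M[C]_(m, n)) : R := Num.sqrt (nrm2 A).

Lemma nrm2_ge0 m n (A : 'M[C]_(m, n)) : 0 <= nrm2 A.
Proof. by rewrite sumr_ge0 // => i _; rewrite sumr_ge0 // => j _; exact: sqr_ge0. Qed.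

Lemma nrm_ge0 m n (A : 'M[C]_(m, n)) : 0 <= nrm A.
Proof. exact: sqrtr_ge0. Qed.
Hint Resolve nrm2_ge0 nrm_ge0 : core.

Lemma nrm_sqr m n (A : 'M[C]_(m, n)) : nrm A ^+ 2 = nrm2 A.
Proof. exact: sqr_sqrtr. Qed.

Lemma nrm2_tr m n (A : 'M[C]_(m, n)) : (nrm2 A)%:C%C = \tr (ctr A *m A).
Proof.
rewrite /nrm2 exchange_big rmorph_sum; apply: eq_bigr => i _.
rewrite mxE rmorph_sum; apply: eq_bigr => j _.
by rewrite ctrE -cabs_sqrC.
Qed.

Lemma nrm2_Re m n (A : 'M[C]_(m, n)) : nrm2 A = Re (\tr (ctr A *m A)).
Proof. by rewrite -nrm2_tr. Qed.

Lemma nrm2_eq0 m n (A : 'M[C]_(m, n)) : (nrm2 A == 0) = (A == 0).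
Proof.
apply/eqP/eqP => [A0|->]; last first.
  rewrite /nrm2 big1 // => i _; rewrite big1 // => j _.
  by rewrite mxE cabs0 expr0n.
apply/matrixP => i j; rewrite mxE; apply/eqP; rewrite -cabs_eq0 -sqrf_eq0.
have := A0 => /eqP; rewrite /nrm2 psumr_eq0 => [|k _]; last first.
  by rewrite sumr_ge0 // => l _; exact: sqr_ge0.
move=> /allP /(_ i (mem_index_enum _)) /=; rewrite psumr_eq0 => [|k _].
  by move=> /allP /(_ j (mem_index_enum _)).
exact: sqr_ge0.
Qed.

Lemma nrm_eq0 m n (A : 'M[C]_(m, n)) : (nrm A == 0) = (A == 0).
Proof. by rewrite -nrm2_eq0 -nrm_sqr sqrf_eq0. Qed.

Lemma nrm0 m n : nrm (0 : 'M[C]_(m, n)) = 0.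
Proof. by apply/eqP; rewrite nrm_eq0. Qed.

Lemma nrm_gt0 m n (A : 'M[C]_(m, n)) : (0 < nrm A) = (A != 0).
Proof. by rewrite lt_def nrm_eq0 nrm_ge0 andbT. Qed.

Lemma nrm2N m n (A : 'M[C]_(m, n)) : nrm2 (- A) = nrm2 A.
Proof. by apply: eq_bigr => i _; apply: eq_bigr => j _; rewrite mxE cabsN. Qed.

Lemma nrmN m n (A : 'M[C]_(m, n)) : nrm (- A) = nrm A.
Proof. by rewrite /nrm nrm2N. Qed.

Lemma nrm2Z m n c (A : 'M[C]_(m, n)) : nrm2 (c *: A) = cabs c ^+ 2 * nrm2 A.
Proof.
rewrite /nrm2 mulr_sumr; apply: eq_bigr => i _; rewrite mulr_sumr.
by apply: eq_bigr => j _; rewrite mxE cabsM exprMn.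
Qed.

Lemma nrm2_ctr m n (A : 'M[C]_(m, n)) : nrm2 (ctr A) = nrm2 A.
Proof.
rewrite /nrm2 exchange_big; apply: eq_bigr => i _; apply: eq_bigr => j _.
by rewrite ctrE cabs_conj.
Qed.

Lemma nrm2D m n (A B : 'M[C]_(m, n)) :
  nrm2 (A + B) = nrm2 A + nrm2 B + 2 * Re (\tr (ctr A *m B)).
Proof.
rewrite !nrm2_Re ctrD mulmxDl !mulmxDr !mxtraceD.
have -> : \tr (ctr B *m A) = conjc (\tr (ctr A *m B)).
  by rewrite -mxtrace_ctr ctrM ctrK.
by case: (\tr (ctr A *m B)) => a b; rewrite !raddfD /=; ring.
Qed.

Lemma nrm2B m n (A B : 'M[C]_(m, n)) :
  nrm2 (A - B) = nrm2 A + nrm2 B - 2 * Re (\tr (ctr A *m B)).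
Proof. by rewrite nrm2D nrm2N mulmxN !raddfN /= mulrN. Qed.

Lemma cauchy_schwarz m n (A B : 'M[C]_(m, n)) :
  cabs (\tr (ctr A *m B)) <= nrm A * nrm B.
Proof.
set w := \tr _; have [A0|A0] := eqVneq A 0.
  by rewrite /w A0 ctr0 mul0mx mxtrace0 cabs0 nrm0 mul0r.
have A2 : 0 < nrm2 A by rewrite lt_def nrm2_eq0 A0 nrm2_ge0.
have := nrm2_ge0 ((nrm2 A)%:C%C *: B - w *: A); rewrite nrm2B !nrm2Z.
rewrite ctrZ -scalemxAl -scalemxAr !mxtraceZ conjc_real ReM_real.
have -> : \tr (ctr B *m A) = conjc w by rewrite -mxtrace_ctr ctrM ctrK.
rewrite [w * _]mulrC -cabs_sqr cabs_real ger0_norm //.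
have -> : nrm2 A ^+ 2 * nrm2 B + cabs w ^+ 2 * nrm2 A
    - 2 * (nrm2 A * cabs w ^+ 2) = nrm2 A * (nrm2 A * nrm2 B - cabs w ^+ 2).
  by ring.
rewrite pmulr_rge0 // subr_ge0 -!nrm_sqr -exprMn.
by rewrite ler_pXn2r ?nnegrE ?mulr_ge0 ?cabs_ge0.
Qed.

Lemma Re_tr_le m n (A B : 'M[C]_(m, n)) : Re (\tr (ctr A *m B)) <= nrm A * nrm B.
Proof. exact: le_trans (Re_le_cabs _) (cauchy_schwarz _ _). Qed.

Lemma ler_nrmD m n (A B : 'M[C]_(m, n)) : nrm (A + B) <= nrm A + nrm B.
Proof.
rewrite -(@ler_pXn2r _ 2) ?nnegrE ?addr_ge0 // nrm_sqr nrm2D sqrrD !nrm_sqr.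
by have := Re_tr_le A B; lra.
Qed.

Lemma ler_nrmB m n (A B : 'M[C]_(m, n)) : nrm (A - B) <= nrm A + nrm B.
Proof. by rewrite -[nrm B]nrmN ler_nrmD. Qed.

Lemma lerB_nrmD m n (A B : 'M[C]_(m, n)) : nrm A - nrm B <= nrm (A + B).
Proof. by rewrite lerBlDr -{1}[A](addrK B) ler_nrmB. Qed.

Lemma ler_nrmM m n p (A : 'M[C]_(m, n)) (B : 'M[C]_(n, p)) :
  nrm (A *m B) <= nrm A * nrm B.
Proof.
rewrite -(@ler_pXn2r _ 2) ?nnegrE ?mulr_ge0 // exprMn !nrm_sqr.
rewrite -[nrm2 A]nrm2_ctr /nrm2.
rewrite [X in X * _]exchange_big [X in _ * X]exchange_big mulr_suml; apply: ler_sum => i _.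
rewrite mulr_sumr; apply: ler_sum => j _.
have nc (k : nat) (x : 'cV[C]_k) : nrm x ^+ 2 = \sum_i cabs (x i 0) ^+ 2.
  by rewrite nrm_sqr /nrm2; apply: eq_bigr => l _; rewrite big_ord1.
have := cauchy_schwarz (col i (ctr A)) (col j B).
move/(lerXn2r 2); rewrite !nnegrE cabs_ge0 mulr_ge0 // => /(_ isT isT).
rewrite exprMn !nc /mxtrace big_ord1 mxE.
rewrite [X in cabs X](_ : _ = (A *m B) i j); last first.
  by rewrite mxE; apply: eq_bigr => k _; rewrite !mxE conjcK.
move/le_trans; apply.
by rewrite [X in X * _ <= _](_ : _ = \sum_k cabs (ctr A k i) ^+ 2)
  1?[X in _ * X <= _](_ : _ = \sum_k cabs (B k j) ^+ 2) //; apply: eq_bigr => k _; rewrite !mxE.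
Qed.

Lemma nrm2_isometry m n p (U : 'M[C]_(m, n)) (A : 'M[C]_(n, p)) :
  orthonormal_cols U -> nrm2 (U *m A) = nrm2 A.
Proof.
by move=> UU; rewrite !nrm2_Re ctrM mulmxA -(mulmxA (ctr A)) UU mulmx1.
Qed.

Lemma nrm_isometry m n p (U : 'M[C]_(m, n)) (A : 'M[C]_(n, p)) :
  orthonormal_cols U -> nrm (U *m A) = nrm A.
Proof. by move=> UU; rewrite /nrm nrm2_isometry. Qed.

Lemma orthonormal_ctr n (U : 'M[C]_n) :
  orthonormal_cols U -> orthonormal_cols (ctr U).
Proof. by rewrite /orthonormal_cols ctrK => /mulmx1C. Qed.

Lemma nrm2_sum_col m n (A : 'M[C]_(m, n)) : nrm2 A = \sum_j nrm2 (col j A).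
Proof.
rewrite /nrm2 exchange_big; apply: eq_bigr => j _; apply: eq_bigr => i _.
by rewrite big_ord1 mxE.
Qed.

Definition opb m n (A : 'M[C]_(m, n)) (c : R) :=
  forall x : 'cV[C]_n, nrm (A *m x) <= c * nrm x.
Definition lob m n (A : 'M[C]_(m, n)) (c : R) :=
  forall x : 'cV[C]_n, c * nrm x <= nrm (A *m x).

Lemma opb_nrm m n (A : 'M[C]_(m, n)) : opb A (nrm A).
Proof. by move=> x; exact: ler_nrmM. Qed.

Lemma opb_le m n (A : 'M[C]_(m, n)) c d : c <= d -> opb A c -> opb A d.
Proof. by move=> cd Ac x; apply: le_trans (Ac x) _; rewrite ler_wpM2r. Qed.

Lemma opbM m n p (A : 'M[C]_(m, n)) (B : 'M[C]_(n, p)) c d :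
  0 <= c -> opb A c -> opb B d -> opb (A *m B) (c * d).
Proof.
move=> c0 Ac Bd x; rewrite -mulmxA -mulrA; apply: le_trans (Ac _) _.
by rewrite ler_wpM2l.
Qed.

Lemma lobM m n p (A : 'M[C]_(m, n)) (B : 'M[C]_(n, p)) c d :
  0 <= c -> lob A c -> lob B d -> lob (A *m B) (c * d).
Proof.
move=> c0 Ac Bd x; rewrite -mulmxA -mulrA; apply: le_trans (Ac _).
by rewrite ler_wpM2l.
Qed.

Lemma opbD m n (A B : 'M[C]_(m, n)) c d : opb A c -> opb B d -> opb (A + B) (c + d).
Proof.
move=> Ac Bd x; rewrite mulmxDl mulrDl; apply: le_trans (ler_nrmD _ _) _.
exact: lerD.
Qed.

Lemma opbN m n (A : 'M[C]_(m, n)) c : opb A c -> opb (- A) c.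
Proof. by move=> Ac x; rewrite mulNmx nrmN. Qed.

Lemma opb_ortho m n (U : 'M[C]_(m, n)) : orthonormal_cols U -> opb U 1.
Proof. by move=> Uo x; rewrite nrm_isometry // mul1r. Qed.

Lemma opb_ge0 m n (A : 'M[C]_(m, n)) c : (0 < n)%N -> opb A c -> 0 <= c.
Proof.
case: n A => // n A _ Ac; pose v : 'cV[C]_n.+1 := const_mx 1.
have v0 : 0 < nrm v.
  by rewrite nrm_gt0; apply/eqP => /matrixP /(_ 0 0) /eqP; rewrite !mxE oner_eq0.
by have := le_trans (nrm_ge0 _) (Ac v); rewrite pmulr_lge0.
Qed.

Lemma opb_ctr m n (A : 'M[C]_(m, n)) c : 0 <= c -> opb A c -> opb (ctr A) c.
Proof.
move=> c0 Ac y; have [->|y0] := eqVneq (ctr A *m y) 0.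
  by rewrite nrm0 mulr_ge0.
rewrite -(@ler_pM2l _ (nrm (ctr A *m y))) ?nrm_gt0 //.
rewrite -expr2 nrm_sqr nrm2_Re ctrM ctrK -mulmxA.
apply: le_trans (Re_tr_le _ _) _.
have -> (a b d : R) : a * (b * d) = d * (b * a) by ring.
by rewrite ler_wpM2l //; exact: Ac.
Qed.

Lemma opb_nrm2 m n p (A : 'M[C]_(m, n)) (X : 'M[C]_(n, p)) c :
  opb A c -> nrm2 (A *m X) <= c ^+ 2 * nrm2 X.
Proof.
move=> Ac; rewrite [nrm2 X]nrm2_sum_col [leLHS]nrm2_sum_col mulr_sumr.
apply: ler_sum => j _; rewrite -!nrm_sqr -exprMn colE -mulmxA -colE.
by apply: lerXn2r; rewrite ?nnegrE //; exact: le_trans (Ac _).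
Qed.

Lemma nrm2_1 n : nrm2 (1%:M : 'M[C]_n) = n%:R.
Proof. by rewrite nrm2_Re ctr1 mulmx1 mxtrace1 -(rmorph_nat (real_complex R)). Qed.

Lemma opb_frob m n (A : 'M[C]_(m, n)) c : opb A c -> nrm2 A <= n%:R * c ^+ 2.
Proof. by move/(@opb_nrm2 _ _ _ _ 1%:M); rewrite mulmx1 nrm2_1 mulrC. Qed.

Lemma lob_unit n (A : 'M[C]_n) c : 0 < c -> lob A c -> A \in unitmx.
Proof.
move=> c0 Ac; rewrite -unitmx_tr -row_free_unit -kermx_eq0.
apply/eqP/row_matrixP => i; rewrite row0; set v := row i _.
have vA : v *m A^T = 0 by rewrite /v -row_mul mulmx_ker row0.
have : A *m v^T = 0 by rewrite -[A]trmxK -trmx_mul vA trmx0.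
move=> h; have := Ac v^T; rewrite h nrm0 pmulr_rle0 // => h'.
have : nrm v^T == 0 by rewrite eq_le h' nrm_ge0.
by rewrite nrm_eq0 -{1}[0]trmx0 => /eqP /trmx_inj.
Qed.

Lemma lob_inv n (A : 'M[C]_n) c : 0 < c -> lob A c -> opb (invmx A) c^-1.
Proof.
move=> c0 Ac x; rewrite mulrC ler_pdivlMr // mulrC; apply: le_trans (Ac _) _.
by rewrite mulKVmx // (lob_unit c0 Ac).
Qed.

Lemma inv_lob n (A : 'M[C]_n) c : A \in unitmx -> 0 < c -> opb (invmx A) c^-1 -> lob A c.
Proof.
move=> Au c0 Ac x; rewrite mulrC -ler_pdivlMr // mulrC; apply: le_trans (Ac _).
by rewrite mulKmx.
Qed.

Lemma ctr_unit n (A : 'M[C]_n) : (ctr A \in unitmx) = (A \in unitmx).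
Proof. by rewrite /ctr unitmx_tr map_unitmx. Qed.

Lemma ctr_inv n (A : 'M[C]_n) : ctr (invmx A) = invmx (ctr A).
Proof. by rewrite /ctr map_invmx trmx_inv. Qed.

Lemma lob_ctr n (A : 'M[C]_n) c : 0 < c -> lob A c -> lob (ctr A) c.
Proof.
move=> c0 Ac; apply: inv_lob => //; first by rewrite ctr_unit (lob_unit c0).
by rewrite -ctr_inv; apply: opb_ctr; [rewrite invr_ge0 ltW | exact: lob_inv].
Qed.

End Norms.

Section Svd.
Variable R : rcfType.
Local Notation C := R[i].

Lemma conj_trmxE m n (A : 'M[C]_(m, n)) : (map_mx Num.conj A^T) = ctr A.
Proof. by apply/matrixP => i j; rewrite !mxE. Qed.

Lemma unitary_ctrP m n (A : 'M[C]_(m, n)) :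
  reflect (orthonormal_cols (ctr A)) (A \is unitarymx).
Proof.
by apply: (iffP (unitarymxP)); rewrite conj_trmxE /orthonormal_cols ctrK.
Qed.

Lemma nrm2_cV n (x : 'cV[C]_n) : nrm2 x = \sum_i cabs (x i 0) ^+ 2.
Proof. by apply: eq_bigr => i _; rewrite big_ord1. Qed.

Lemma nrm2_diagR m n (s : nat -> R) (y : 'cV[C]_n) :
  (forall i, (m <= i)%N -> s i = 0) ->
  nrm2 (diagR m n s *m y) = \sum_(j < n) s j ^+ 2 * cabs (y j 0) ^+ 2.
Proof.
move=> s0; rewrite nrm2_cV.
transitivity (\sum_(i < m) \sum_(j < n)
    (if (i : nat) == j then s j ^+ 2 * cabs (y j 0) ^+ 2 else 0)).
  apply: eq_bigr => i _; rewrite mxE.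
  have [lt_in|le_ni] := ltnP i n.
    rewrite (bigD1 (Ordinal lt_in)) //= [in RHS](bigD1 (Ordinal lt_in)) //= !mxE /= eqxx.
    rewrite !big1 ?addr0 ?cabsM ?cabs_real ?exprMn ?real_normK ?num_real //.
      move=> j nj; case: eqP => // ij; case/eqP: nj; exact: val_inj.
    move=> j nj; rewrite mxE; case: eqP => [ij|_]; last by rewrite mul0r.
    by case/eqP: nj; exact: val_inj.
  rewrite !big1 ?cabs0 ?expr0n //.
    by move=> j _; case: eqP => // ij; move: (ltn_ord j); rewrite -ij ltnNge le_ni.
  move=> j _; rewrite mxE; case: eqP => [ij|_]; last by rewrite mul0r.
  by move: (ltn_ord j); rewrite -ij ltnNge le_ni.
rewrite exchange_big; apply: eq_bigr => j _.
have [lt_jm|le_mj] := ltnP j m.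
  rewrite (bigD1 (Ordinal lt_jm)) //= eqxx big1 ?addr0 // => i ni.
  by case: eqP => // ij; case/eqP: ni; exact: val_inj.
by rewrite s0 // expr0n mul0r big1 // => i _; case: ifP.
Qed.

Lemma svd_nrm2 m n (A : 'M[C]_(m, n)) U s V (x : 'cV[C]_n) : is_svd A U s V ->
  nrm2 (A *m x) = \sum_(j < n) s j ^+ 2 * cabs ((ctr V *m x) j 0) ^+ 2.
Proof.
move=> [[Uo Vo] _ _ s0 ->]; rewrite -!mulmxA nrm2_isometry //.
apply: nrm2_diagR => i mi; apply: s0; exact: leq_trans (geq_minl _ _) mi.
Qed.

Lemma orthonormal_complete n p (W : 'M[C]_(n + p, n)) : orthonormal_cols W ->
  exists Y : 'M[C]_(n + p, p), orthonormal_cols (row_mx W Y).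
Proof.
move=> Wo.
have Wu : ctr W \is unitarymx by apply/unitary_ctrP; rewrite ctrK.
suff: exists Y : 'M[C]_(p, n + p), Y \is unitarymx /\ ctr W *m ctr Y = 0.
  case=> Y [/unitary_ctrP Yu WY]; exists (ctr Y).
  rewrite /orthonormal_cols {1}/ctr map_row_mx tr_row_mx mul_col_row.
  rewrite -!/(ctr _) Wo WY Yu.
  have -> : ctr (ctr Y) *m W = 0.
    by rewrite -[W]ctrK -ctrM WY ctr0.
  by rewrite -scalar_mx_block.
set O := orthomx Num.conj (mx_of_hermitian (hermitian1mx (n + p))) (ctr W).
have rO : \rank O = p.
  by rewrite /O rank_ortho mxrank_unitary // addKn.
suff: exists Y : 'M[C]_(\rank O, n + p), Y \is unitarymx /\ ctr W *m ctr Y = 0.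
  by rewrite rO.
exists (schmidt (row_base O)); split; first exact: schmidt_unitarymx (rank_leq_col _).
have /orthomx1P : (schmidt (row_base O) <= O)%MS.
  by rewrite eqmx_schmidt_free ?row_base_free // eq_row_base.
rewrite conj_trmxE ctrK => YW.
by rewrite -ctrM YW ctr0.
Qed.

Lemma perm_sort_decr n (f : 'I_n -> R) :
  exists p : 'S_n, forall i j : 'I_n, (i <= j)%N -> f (p j) <= f (p i).
Proof.
pose t := [tuple f i | i < n]; pose r := fun x y : R => y <= x.
have [p pE] : exists p : 'S_n, sort r t = [tuple tnth t (p i) | i < n] :> seq R.
  by apply/tuple_permP; rewrite perm_sort.
exists p => i j; rewrite leq_eqVlt => /predU1P[/val_inj -> //|lt_ij].
have rT : transitive r by move=> a b c ba cb; exact: le_trans cb ba.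
have rtot : total r by move=> a b; exact: le_total.
have := sort_sorted rtot t; rewrite pE => srt.
have := sorted_ltn_nth rT 0 srt; move=> /(_ i j).
rewrite !inE size_tuple => /(_ (ltn_ord i) (ltn_ord j) lt_ij).
by rewrite -!tnth_nth !tnth_mktuple.
Qed.

Lemma gram_diag n m (A : 'M[C]_(m, n)) : exists V : 'M[C]_n,
  orthonormal_cols V /\ forall i j, i != j -> (ctr (A *m V) *m (A *m V)) i j = 0.
Proof.
pose H := ctr A *m A.
have Hn : H \is normalmx by apply/normalmxP; rewrite conj_trmxE /H !ctrM !ctrK.
exists (ctr (spectralmx H)); split.
  by apply/unitary_ctrP; rewrite spectral_unitarymx.
move=> i j nij; rewrite ctrM ctrK -mulmxA (mulmxA (ctr A)) -/H.
rewrite {2}(orthomx_spectralP Hn) -conj_trmxE -invmx_unitary ?spectral_unitarymx //.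
by rewrite !mulmxA mulmxV ?spectral_unit // mul1mx mulmxK ?spectral_unit // mxE (negbTE nij).
Qed.

Lemma conjcZ (a : R) (b : C) : conjc (a%:C%C * b) = a%:C%C * conjc b.
Proof. by rewrite -[LHS]/(Num.conj _) rmorphM /= -[Num.conj a%:C%C]/(conjc _) conjc_real. Qed.

Lemma svd_exists p n (A : 'M[C]_(n + p, n)) :
  (forall x : 'cV[C]_n, A *m x = 0 -> x = 0) ->
  exists U s V, is_svd A U s V.
Proof.
move=> Ainj; have [V0 [V0o V0d]] := gram_diag A.
pose f j := nrm (A *m col j V0); have [q qdec] := perm_sort_decr f.
pose V : 'M[C]_n := \matrix_(i, j) V0 i (q j).
have colV j : col j V = col (q j) V0 by apply/colP => i; rewrite !mxE.
have Vo : orthonormal_cols V.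
  apply/matrixP => i j; have := congr1 (fun M : 'M_n => M (q i) (q j)) V0o.
  rewrite !mxE (inj_eq perm_inj) => <-; apply: eq_bigr => k _.
  by rewrite !mxE.
have f0 j : f j != 0.
  rewrite nrm_eq0; apply/eqP => /Ainj.
  move=> /(congr1 (fun x => nrm2 x)); rewrite colE nrm2_isometry // => /eqP.
  rewrite (eqP (_ : nrm2 0 == 0)) ?nrm2_eq0 // => /eqP /matrixP /(_ j 0).
  by move/eqP; rewrite !mxE !eqxx oner_eq0.
pose s k := if insub k is Some j then f (q j) else 0.
have sE (j : 'I_n) : s j = f (q j) by rewrite /s valK.
pose W : 'M[C]_(n + p, n) := \matrix_(i, j) ((s j)^-1%:C%C * (A *m V) i j).
have AVE : A *m V = W *m diag_mx (\row_j (s j)%:C%C).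
  apply/matrixP => i j; rewrite mul_mx_diag [RHS]mxE [W i j]mxE [X in _ * X]mxE mulrAC -rmorphM.
  by rewrite mulVf ?mul1r // sE.
have Wo : orthonormal_cols W.
  apply/matrixP => i j.
  have -> : (ctr W *m W) i j = (s i)^-1%:C%C * (s j)^-1%:C%C *
      (ctr (A *m V0) *m (A *m V0)) (q i) (q j).
    rewrite [LHS]mxE [X in _ = _ * X]mxE mulr_sumr; apply: eq_bigr => k _.
    rewrite !ctrE [W k i]mxE [W k j]mxE conjcZ.
    have AVk l : (A *m V) k l = (A *m V0) k (q l).
      by rewrite !mxE; apply: eq_bigr => u _; rewrite mxE.
    by rewrite !AVk mulrACA.
  have [<-|nij] := eqVneq i j; last first.
    by rewrite V0d ?mulr0 ?mxE ?(negbTE nij) // (inj_eq perm_inj).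
  have -> : (ctr (A *m V0) *m (A *m V0)) (q i) (q i) = (f (q i) ^+ 2)%:C%C.
    rewrite nrm_sqr nrm2_tr /mxtrace big_ord1 !mxE; apply: eq_bigr => k _.
    rewrite !ctrE colE mulmxA -colE !mxE; congr (conjc _ * _).
  by rewrite sE -!rmorphM expr2 mulrACA mulVf // mul1r mxE eqxx.
have [Y WYo] := orthonormal_complete Wo.
exists (row_mx W Y), s, V; split.
- by [].
- move=> i j ij; rewrite minnE; have -> : (n + p - (n + p - n) = n)%N by rewrite addKn addnK.
  move=> jn; have := qdec (Ordinal (leq_ltn_trans ij jn)) (Ordinal jn) ij.
  by rewrite -!sE.
- by move=> i _; rewrite /s; case: insub => // j; rewrite nrm_ge0.
- move=> i; rewrite (minn_idPr (leq_addr _ _)) /s => ni.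
  by case: insubP => // j; rewrite ltnNge ni.
have -> : diagR (n + p) n s = col_mx (diag_mx (\row_j (s j)%:C%C)) 0.
  apply/matrixP => i j; rewrite !mxE; case: split_ordP => k ->; rewrite !mxE /=.
    by rewrite -val_eqE /=; case: eqP => [->|]; rewrite ?mulr1n ?mulr0n.
  by case: eqP => // kj; move: (ltn_ord j); rewrite -kj ltnNge leq_addr.
rewrite mul_row_col mulmx0 addr0 -AVE -mulmxA.
by rewrite (mulmx1C Vo) mulmx1.
Qed.

Lemma svd_exists_tall m n (A : 'M[C]_(m, n)) : (n <= m)%N ->
  (forall x : 'cV[C]_n, A *m x = 0 -> x = 0) -> exists U s V, is_svd A U s V.
Proof.
move=> nm; have [p mE] : exists p, m = (n + p)%N by exists (m - n)%N; rewrite subnKC.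
by case: _ / (esym mE) in A *; exact: svd_exists.
Qed.

Lemma svd_sv_ge m n (A : 'M[C]_(m, n)) U s V c (j : 'I_n) : is_svd A U s V ->
  (n <= m)%N -> lob A c -> c <= s j.
Proof.
move=> As nm Ac; have := As; case=> [[Uo Vo] _ s0 _ _].
have := Ac (col j V); rewrite colE nrm_isometry // -colE.
have nj : nrm2 (delta_mx j 0 : 'cV[C]_n) = 1.
  rewrite nrm2_cV (bigD1 j) //= mxE !eqxx cabs1 expr1n big1 ?addr0 // => i ij.
  by rewrite mxE (negbTE ij) cabs0 expr0n.
have -> : nrm (delta_mx j 0 : 'cV[C]_n) = 1 by rewrite /nrm nj sqrtr1.
rewrite mulr1 => /le_trans; apply.
have sj : 0 <= s j by apply: s0; rewrite (minn_idPr nm).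
rewrite -(@ler_pXn2r _ 2) ?nnegrE ?nrm_ge0 // nrm_sqr colE (svd_nrm2 _ As) mulmxA Vo mul1mx.
rewrite (bigD1 j) //= mxE !eqxx cabs1 expr1n mulr1 big1 ?addr0 // => i ij.
by rewrite mxE (negbTE ij) cabs0 expr0n mulr0.
Qed.

Lemma svd_opb m n (A : 'M[C]_(m, n)) U s V : is_svd A U s V -> (n <= m)%N ->
  opb A (s 0%N).
Proof.
move=> As nm x; have := As; case=> [[Uo Vo] sdec s0 _ _].
have [n0|n0] := posnP n.
  have -> : x = 0 by apply/colP => i; have := ltn_ord i; rewrite [X in (_ < X)%N]n0.
  by rewrite mulmx0 !nrm0 mulr0.
rewrite -(@ler_pXn2r _ 2) ?nnegrE ?mulr_ge0 ?nrm_ge0 ?s0 ?(minn_idPr nm) //.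
rewrite exprMn !nrm_sqr (svd_nrm2 _ As).
rewrite -(nrm2_isometry x (orthonormal_ctr Vo)) nrm2_cV mulr_sumr.
apply: ler_sum => j _; apply: ler_wpM2r; first exact: sqr_ge0.
by apply: lerXn2r; rewrite ?nnegrE ?s0 ?sdec ?(minn_idPr nm).
Qed.

Lemma svd_lob m n (A : 'M[C]_(m, n)) U s V : is_svd A U s V -> (n <= m)%N ->
  lob A (s n.-1).
Proof.
move=> As nm x; have := As; case=> [[Uo Vo] sdec s0 _ _].
have [n0|n0] := posnP n.
  have -> : x = 0 by apply/colP => i; have := ltn_ord i; rewrite [X in (_ < X)%N]n0.
  by rewrite mulmx0 !nrm0 mulr0.
rewrite -(@ler_pXn2r _ 2) ?nnegrE ?mulr_ge0 ?nrm_ge0 ?s0 ?(minn_idPr nm) ?ltn_predL //.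
rewrite exprMn !nrm_sqr (svd_nrm2 _ As).
rewrite -(nrm2_isometry x (orthonormal_ctr Vo)) nrm2_cV mulr_sumr.
apply: ler_sum => j _; apply: ler_wpM2r; first exact: sqr_ge0.
apply: lerXn2r; rewrite ?nnegrE ?s0 ?sdec ?(minn_idPr nm) ?ltn_predL //.
by rewrite -ltnS prednK.
Qed.

Section TallInjective.
Variables (m n : nat) (A : 'M[C]_(m, n)).
Hypotheses (n0 : (0 < n)%N) (nm : (n <= m)%N).
Hypothesis Ainj : forall x : 'cV[C]_n, A *m x = 0 -> x = 0.

Lemma singvalP i : exists U s V, is_svd A U s V /\ s i = singval A i.
Proof.
apply: (epsilon_spec (inhabits 0)
  (fun x => exists U s V, is_svd A U s V /\ s i = x)).
have [U [s [V As]]] := svd_exists_tall nm Ainj.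
by exists (s i), U, s, V.
Qed.

Lemma opb_sigma_max : opb A (sigma_max A).
Proof. by rewrite /sigma_max; have [U [s [V [As <-]]]] := singvalP 0; exact: svd_opb As nm. Qed.

Lemma lob_sigma_min : lob A (sigma_min A).
Proof.
rewrite /sigma_min (minn_idPr nm).
by have [U [s [V [As <-]]]] := singvalP n.-1; exact: svd_lob As nm.
Qed.

Lemma sigma_min_gt0 : 0 < sigma_min A.
Proof.
rewrite /sigma_min (minn_idPr nm).
have [U [s [V [As <-]]]] := singvalP n.-1.
have := As; case=> [[Uo Vo] _ s0 _ _].
rewrite lt_def s0 ?(minn_idPr nm) ?ltn_predL // andbT; apply/eqP => sn.
have ln : (n.-1 < n)%N by rewrite ltn_predL.
pose j := Ordinal ln; pose e := delta_mx j 0 : 'cV[C]_n.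
have e0 : e != 0.
  by apply/eqP => /matrixP /(_ j 0) /eqP; rewrite !mxE !eqxx oner_eq0.
have : nrm2 (A *m (V *m e)) == 0.
  rewrite (svd_nrm2 _ As) big1 // => i _; rewrite mulmxA Vo mul1mx mxE.
  have [->|ij] := eqVneq i j; first by rewrite sn expr0n mul0r.
  by rewrite cabs0 expr0n mulr0.
rewrite nrm2_eq0 => /eqP /Ainj Ve; case/eqP: e0.
by rewrite -[e]mul1mx -Vo -mulmxA Ve mulmx0.
Qed.

Lemma sigma_min_le_max : sigma_min A <= sigma_max A.
Proof.
have v0 : 0 < nrm (const_mx 1 : 'cV[C]_n).
  rewrite nrm_gt0; apply/eqP => /matrixP /(_ (Ordinal n0) 0) /eqP.
  by rewrite !mxE oner_eq0.
have := le_trans (lob_sigma_min (const_mx 1)) (opb_sigma_max (const_mx 1)).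
by rewrite ler_pM2r.
Qed.

End TallInjective.

Lemma vander_inj K M (z : 'I_K -> C) : (K <= M)%N -> injective z ->
  forall x : 'cV[C]_K, vander z M *m x = 0 -> x = 0.
Proof.
move=> KM zinj x Vx; apply/colP => k; rewrite mxE.
pose p := \prod_(j < K | j != k) ('X - (z j)%:P).
have sp : (size p <= M)%N.
  rewrite /p -big_filter size_prod_XsubC -sum1_size big_filter sum1_card cardC1.
  by rewrite card_ord prednK // (leq_ltn_trans _ (ltn_ord k)).
have moments l : (l < M)%N -> \sum_j z j ^+ l * x j 0 = 0.
  move=> lM; have /matrixP /(_ (Ordinal lM) 0) := Vx; rewrite !mxE => h.
  by rewrite -[RHS]h; apply: eq_bigr => j _; rewrite mxE.
have : \sum_j p.[z j] * x j 0 = 0.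
  under eq_bigr do rewrite (horner_coef_wide _ sp) mulr_suml.
  rewrite exchange_big big1 //= => l _.
  under eq_bigr do rewrite -mulrA.
  by rewrite -mulr_sumr moments // mulr0.
rewrite (bigD1 k) //= big1 => [|j jk]; last first.
  by rewrite /p (bigD1 j) //= hornerM hornerXsubC subrr !mul0r.
rewrite addr0 => /eqP; rewrite mulf_eq0 => /orP[|/eqP //].
rewrite /p horner_prod prodf_seq_eq0 => /hasP[j _ /andP[jk]].
by rewrite hornerXsubC subr_eq0 => /eqP /zinj kj; rewrite kj eqxx in jk.
Qed.

End Svd.

Section Matching.

Lemma hall (T : finType) (r : rel T) (A B : {set T}) :
  (forall X : {set T}, X \subset A ->
     #|X| <= #|[set y in B | [exists x in X, r x y]]|)%N ->
  exists f : T -> T, {in A &, injective f} /\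
    (forall x, x \in A -> r x (f x) && (f x \in B)).
Proof.
pose N (D X : {set T}) := [set y in D | [exists x in X, r x y]].
have [k] := ubnP #|A|; elim: k A B => // k IHk A B Ak.
rewrite -[X in X -> _]/(forall X : {set T}, X \subset A -> #|X| <= #|N B X|)%N => hyp.
have [->|[a aA]] := set_0Vmem A.
  by exists id; split=> x; rewrite inE.
have inN D X y : (y \in N D X) = (y \in D) && [exists x in X, r x y] by rewrite inE.
case: (pickP (fun X : {set T} => [&& X \proper A, X != set0 & #|N B X| <= #|X|])%N).
  move=> X /and3P[XA X0 NX].
  have [||f1 [f1i f1r]] := IHk X (N B X).
  - by rewrite (leq_trans (proper_card XA)).
  - move=> Y YX; change (#|Y| <= #|N (N B X) Y|)%N; have -> : N (N B X) Y = N B Y.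
      apply/setP => y; rewrite !inN -andbA; congr (_ && _).
      apply/andb_idl => /existsP[x /andP[xY rxy]].
      by apply/existsP; exists x; rewrite (subsetP YX).
    by apply: hyp; exact: subset_trans YX (proper_sub XA).
  have [||f2 [f2i f2r]] := IHk (A :\: X) (B :\: N B X).
  - rewrite cardsDS ?proper_sub //; have := proper_card XA.
    have : (0 < #|X|)%N by rewrite card_gt0.
    by lia.
  - move=> Y YA; change (#|Y| <= #|N (B :\: N B X) Y|)%N; rewrite -(leq_add2l #|N B X|).
    have disj : [disjoint X & Y].
      by rewrite disjoint_sym (disjointWl YA) // -setI_eq0 setDE -setIA [~: X :&: X]setIC setICr setI0.
    have : (#|X :|: Y| <= #|N B (X :|: Y)|)%N.
      apply: hyp; rewrite subUset (proper_sub XA) /=.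
      exact: subset_trans YA (subsetDl _ _).
    have -> : N B (X :|: Y) = N B X :|: N (B :\: N B X) Y.
      apply/setP => y; rewrite in_setU !inN in_setD !inN.
      have -> : [exists x in X :|: Y, r x y] = [exists x in X, r x y] || [exists x in Y, r x y].
        apply/existsP/orP => [[x]|[] /existsP[x /andP[xX rxy]]].
        - rewrite inE => /andP[/orP[xX|xY] rxy].
            by left; apply/existsP; exists x; rewrite xX.
          by right; apply/existsP; exists x; rewrite xY.
        - by exists x; rewrite inE xX.
        - by exists x; rewrite inE xX orbT.
      by case: (y \in B); case: [exists x in X, _]; case: [exists x in Y, _].
    rewrite !cardsU (disjoint_setI0 disj) cards0 subn0.
    have -> : N B X :&: N (B :\: N B X) Y = set0.
      by apply/setP => y; rewrite in_setI [y \in N (_ :\: _) _]inN in_setD in_set0; case: (y \in N B X).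
    by rewrite cards0 subn0; apply: leq_trans; rewrite leq_add2r.
  exists (fun x => if x \in X then f1 x else f2 x); split; last first.
    move=> x xA; case: ifP => xX.
      by have := f1r x xX; rewrite inN => /and3P[-> ->].
    by have := f2r x; rewrite in_setD xA xX => /(_ isT) /andP[->]; rewrite in_setD => /andP[].
  have f12 x y : x \in X -> y \in A -> y \notin X -> f1 x = f2 y -> False.
    move=> xX yA yX e; have := f1r x xX; have := f2r y.
    by rewrite in_setD yA yX in_setD e => /(_ isT) /and3P[_ /negbTE ->]; rewrite andbF.
  move=> x y xA yA; case: ifPn => xX; case: ifPn => yX.
  - exact: f1i.
  - by move/(f12 _ _ xX yA yX).
  - by move/esym/(f12 _ _ yX xA xX).
  - by apply: f2i; rewrite in_setD ?xX ?yX.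
move=> strict.
have [b /andP[bB rab]] : exists b, (b \in B) && r a b.
  have := hyp [set a]; rewrite sub1set aA cards1 => /(_ isT).
  rewrite card_gt0 => /set0Pn[b]; rewrite inN => /andP[bB /existsP[x]].
  by rewrite inE => /andP[/eqP -> rab]; exists b; rewrite bB.
have [||f [fi fr]] := IHk (A :\ a) (B :\ b).
- by rewrite (cardsD1 a) aA in Ak.
- move=> X XA; change (#|X| <= #|N (B :\ b) X|)%N.
  have [->|X0] := eqVneq X set0; first by rewrite cards0.
  have aX : a \notin X by apply/negP => /(subsetP XA); rewrite !inE eqxx.
  have XA' : X \proper A.
    rewrite properE (subset_trans XA (subsetDl _ _)) /=.
    by apply/negP => /subsetP /(_ a aA); rewrite (negbTE aX).
  have /negbT := strict X; rewrite XA' X0 /= -ltnNge => lt.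
  have -> : N (B :\ b) X = N B X :\ b.
    by apply/setP => y; rewrite in_setD1 !inN in_setD1 andbA.
  rewrite -ltnS; apply: leq_trans lt _; rewrite (cardsD1 b (N B X)).
  by rewrite -add1n leq_add2r leq_b1.
exists (fun x => if x == a then b else f x); split; last first.
  move=> x xA; case: eqP => [->|/eqP xa]; first by rewrite rab.
  by have := fr x; rewrite !inE xa xA => /(_ isT) /and3P[-> _ ->].
have fb x : x \in A -> x != a -> f x != b.
  by move=> xA xa; have := fr x; rewrite !inE xa xA => /(_ isT) /and3P[].
move=> x y xA yA; case: (eqVneq x a) => [->|xa]; case: (eqVneq y a) => [->|ya] //.
- by move=> e; have := fb y yA ya; rewrite -e eqxx.
- by move=> e; have := fb x xA xa; rewrite e eqxx.
- by apply: fi; rewrite !inE ?xa ?ya.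
Qed.

Lemma bistochastic_matching (R : realFieldType) n (S c : 'I_n -> 'I_n -> R) (t : R) :
  (forall i j, 0 <= S i j) -> (forall i j, 0 <= c i j) ->
  (forall i, \sum_j S i j = 1) -> (forall j, \sum_i S i j = 1) ->
  \sum_i \sum_j S i j * c i j <= t ->
  exists p : 'S_n, forall i, c i (p i) <= t.
Proof.
move=> S0 c0 Srow Scol Sc.
pose r i j := c i j <= t.
have [X _|f [fi fr]] := @hall _ r setT setT; last first.
  have finj : injective f by move=> x y; apply: fi; rewrite inE.
  exists (perm finj) => i; rewrite permE.
  by have := fr i (in_setT _); case/andP.
set NX := [set y in _ | _].
rewrite leqNgt; apply/negP => ltX.
have mass : 1 <= \sum_(i in X) \sum_(j in ~: NX) S i j.
  have -> : \sum_(i in X) \sum_(j in ~: NX) S i j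
          = #|X|%:R - \sum_(i in X) \sum_(j in NX) S i j.
    rewrite -sumr_const -sumrB; apply: eq_bigr => i _.
    rewrite -(Srow i) [X in X - _](bigID (mem NX)) /= addrAC subrr add0r.
    by apply: eq_bigl => j; rewrite inE.
  have : \sum_(i in X) \sum_(j in NX) S i j <= #|NX|%:R.
    rewrite exchange_big -sumr_const; apply: ler_sum => j _.
    rewrite -(Scol j) [leRHS](bigID (mem X)) /= lerDl.
    exact: sumr_ge0.
  have : #|NX|%:R + 1 <= #|X|%:R :> R by rewrite natr1 ler_nat.
  by lra.
have big i j : i \in X -> j \in ~: NX -> t < c i j.
  move=> iX; rewrite !inE /= => jN; rewrite ltNge; apply: contra jN => cij.
  by apply/existsP; exists i; rewrite iX.
have low : \sum_(i in X) \sum_(j in ~: NX) S i j * c i j <= t.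
  apply: le_trans Sc; rewrite [leRHS](bigID (mem X)) /= -[leLHS]addr0.
  apply: lerD; last by do 2!apply: sumr_ge0 => ? _; exact: mulr_ge0.
  apply: ler_sum => i _; rewrite [leRHS](bigID (mem (~: NX))) /= lerDl.
  by apply: sumr_ge0 => ? _; exact: mulr_ge0.
have t0 : 0 <= t.
  by apply: le_trans Sc; do 2!apply: sumr_ge0 => ? _; exact: mulr_ge0.
have zero : \sum_(i in X) \sum_(j in ~: NX) S i j * (c i j - t) = 0.
  apply/eqP; rewrite eq_le; apply/andP; split; last first.
    do 2!apply: sumr_ge0 => ? ?; apply: mulr_ge0 => //.
    by rewrite subr_ge0 ltW // big.
  under eq_bigr do (under eq_bigr do rewrite mulrBr; rewrite sumrB -mulr_suml).
  rewrite sumrB -mulr_suml subr_le0; apply: le_trans low _.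
  by rewrite ler_peMl.
have : \sum_(i in X) \sum_(j in ~: NX) S i j = 0.
  apply: big1 => i iX; apply: big1 => j jN.
  have pos i' j' : i' \in X -> j' \in ~: NX -> 0 <= S i' j' * (c i' j' - t).
    by move=> *; rewrite mulr_ge0 // subr_ge0 ltW // big.
  have zi := psumr_eq0P (fun k kX => sumr_ge0 _ (fun l lN => pos k l kX lN)) zero.
  have /eqP := psumr_eq0P (fun l => pos i l iX) (zi i iX) jN.
  by rewrite mulf_eq0 subr_eq0 (gt_eqF (big _ _ iX jN)) orbF => /eqP.
by move=> s0; move: mass; rewrite s0 ler10.
Qed.

End Matching.

Section Sun.
Variable R : rcfType.
Local Notation C := R[i].

(* Equating the i-th diagonal entries of [N N^*] and [N^* N] gives equal weight to row i
   and column i; summing these identities with coefficient i yields [sum (i - j) |N_ij|^2 = 0]. *)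
Lemma normal_upper_le_lower n (N : 'M[C]_n.+1) : ctr N *m N = N *m ctr N ->
  \sum_(i < n.+1) \sum_(j < n.+1 | (i < j)%N) cabs (N i j) ^+ 2 <=
  n%:R * \sum_(i < n.+1) \sum_(j < n.+1 | (j < i)%N) cabs (N i j) ^+ 2.
Proof.
move=> Nn; pose a i j := cabs (N i j) ^+ 2.
have a0 i j : 0 <= a i j by exact: sqr_ge0.
have rowcol (i : 'I_n.+1) : \sum_j a i j = \sum_j a j i.
  have := congr1 (fun M : 'M[C]_n.+1 => M i i) Nn; rewrite !mxE => e.
  apply: (@complexI R); rewrite !rmorph_sum /=.
  transitivity (\sum_j N i j * ctr N j i).
    by apply: eq_bigr => j _; rewrite cabs_sqrC ctrE mulrC.
  by rewrite -e; apply: eq_bigr => j _; rewrite cabs_sqrC ctrE.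
have zero : \sum_(i < n.+1) \sum_(j < n.+1) (i%:R - j%:R) * a i j = 0.
  under eq_bigr do (under eq_bigr do rewrite mulrBl; rewrite sumrB -mulr_sumr).
  rewrite sumrB [X in _ - X]exchange_big -sumrB big1 // => i _.
  by rewrite -mulr_sumr -mulrBr rowcol subrr mulr0.
have split_ij : \sum_(i < n.+1) \sum_(j < n.+1) (i%:R - j%:R) * a i j =
    \sum_(i < n.+1) \sum_(j < n.+1 | (j < i)%N) (i%:R - j%:R) * a i j
    - \sum_(i < n.+1) \sum_(j < n.+1 | (i < j)%N) (j%:R - i%:R) * a i j.
  rewrite -sumrB; apply: eq_bigr => i _.
  rewrite (bigID (fun j : 'I_n.+1 => (j < i)%N)) /=; congr (_ + _).
  rewrite -sumrN (bigID (fun j : 'I_n.+1 => (i < j)%N)) /= [X in _ + X]big1 ?addr0.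
    apply: eq_big => j; first by rewrite -leqNgt; case: ltngtP.
    by move=> _; rewrite -mulNr opprB.
  move=> j; rewrite -!leqNgt -eqn_leq => /eqP ->.
  by rewrite subrr mul0r.
apply: (@le_trans _ _ (\sum_(i < n.+1) \sum_(j < n.+1 | (i < j)%N) (j%:R - i%:R) * a i j)).
  apply: ler_sum => i _; apply: ler_sum => j ij; apply: ler_peMl (a0 i j) _.
  by rewrite lerBrDr addrC natr1 ler_nat.
move/eqP: zero; rewrite split_ij subr_eq0 => /eqP <-.
rewrite mulr_sumr; apply: ler_sum => i _; rewrite mulr_sumr; apply: ler_sum => j _.
rewrite ler_wpM2r //; apply: (@le_trans _ _ i%:R); first by rewrite lerBlDr lerDl.
by rewrite ler_nat -ltnS.
Qed.

Lemma normal_conj n (P D : 'M[C]_n) : orthonormal_cols P -> ctr D *m D = D *m ctr D ->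
  ctr (P *m D *m ctr P) *m (P *m D *m ctr P) = P *m D *m ctr P *m ctr (P *m D *m ctr P).
Proof.
move=> Po Dn; have -> : ctr (P *m D *m ctr P) = P *m ctr D *m ctr P.
  by rewrite !ctrM ctrK mulmxA.
have PP (X Y : 'M[C]_n) : P *m X *m ctr P *m (P *m Y *m ctr P) = P *m (X *m Y) *m ctr P.
  by rewrite !mulmxA -(mulmxA _ (ctr P)) Po mulmx1.
by rewrite !PP Dn.
Qed.

Lemma char_poly_conj n (P A : 'M[C]_n) : P \in unitmx ->
  char_poly (P *m A *m invmx P) = char_poly A.
Proof.
move=> Pu; rewrite /char_poly.
have -> : char_poly_mx (P *m A *m invmx P)
        = map_mx polyC P *m char_poly_mx A *m map_mx polyC (invmx P).
  rewrite /char_poly_mx mulmxBr mulmxBl -!map_mxM; congr (_ - _).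
  by rewrite mul_mx_scalar -scalemxAl -map_mxM mulmxV // map_mx1 scalemx1.
rewrite !det_mulmx mulrAC -det_mulmx -map_mxM mulmxV //.
by rewrite map_mx1 det1 mul1r.
Qed.

Lemma eq_prod_XsubC_perm n (f g : 'I_n -> C) :
  \prod_i ('X - (f i)%:P) = \prod_i ('X - (g i)%:P) ->
  exists p : 'S_n, forall i, f i = g (p i).
Proof.
move=> e.
have : perm_eq [tuple f i | i < n] [tuple g i | i < n].
  by apply: prod_XsubC_eq; rewrite !big_tuple; under eq_bigr do rewrite tnth_mktuple;
     under [RHS]eq_bigr do rewrite tnth_mktuple.
move/tuple_permP => [p fE]; exists p => i.
have /val_inj /(congr1 (fun t => tnth t i)) := fE.
by rewrite !tnth_mktuple.
Qed.

Lemma sum_diag_upper_lower n (g : 'I_n -> 'I_n -> R) :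
  \sum_(i < n) \sum_(j < n) g i j = \sum_(i < n) g i i
    + \sum_(i < n) \sum_(j < n | (i < j)%N) g i j
    + \sum_(i < n) \sum_(j < n | (j < i)%N) g i j.
Proof.
rewrite -!big_split; apply: eq_bigr => i _ /=.
rewrite (bigD1 i) //= -addrA; congr (_ + _).
rewrite (bigID (fun j : 'I_n => (i < j)%N)) /=; congr (_ + _); apply: eq_bigl => j.
  by rewrite -val_eqE /=; case: ltngtP.
by rewrite -val_eqE /=; case: ltngtP.
Qed.

(* J.-g. Sun's argument: in a (lower triangular) Schur basis of the perturbed matrix, the
   strictly lower part of the normal unperturbed one is controlled by its strictly upper part,
   which belongs to the perturbation; this reduces the problem to Hoffman-Wielandt. *)
Lemma spectral_variation_normal n (z w : 'I_n.+1 -> C) (F : 'M[C]_n.+1) f :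
  opb F f -> char_poly (diag_mx (\row_k z k) + F) = \prod_k ('X - (w k)%:P) ->
  exists p : 'S_n.+1, forall k, cabs (w (p k) - z k) <= n.+1%:R * f.
Proof.
move=> Ff; set D := diag_mx _; set B := D + F => Bw.
have f0 : 0 <= f by exact: opb_ge0 Ff.
have [P Pu] := @Schur _ n.+1 B isT; rewrite /similar_to /=.
rewrite conjymx // conj_trmxE => Ttrig; set T := P *m B *m ctr P in Ttrig.
have Pinv : invmx P = ctr P by rewrite invmx_unitary // conj_trmxE.
have Pc : orthonormal_cols (ctr P) by apply/unitary_ctrP.
have Po : orthonormal_cols P by move/orthonormal_ctr: Pc; rewrite ctrK.
have [s sE] : exists s : 'S_n.+1, forall i, T i i = w (s i).
  apply: eq_prod_XsubC_perm; rewrite -Bw -(char_poly_conj B (unitarymx_unit Pu)).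
  by rewrite Pinv -/T char_poly_trig.
pose A := P *m D *m ctr P; pose E := P *m F *m ctr P.
have TE : T = A + E by rewrite /T /B mulmxDr mulmxDl.
have Zn : ctr D *m D = D *m ctr D.
  have -> : ctr D = diag_mx (\row_k conjc (z k)).
    apply/matrixP => i j; rewrite ctrE !mxE.
    by rewrite eq_sym; case: eqP => [->|]; rewrite ?mulr1n ?mulr0n ?conjc0.
  by rewrite !mulmx_diag; congr diag_mx; apply/rowP => k; rewrite !mxE mulrC.
have An : ctr A *m A = A *m ctr A.
  exact: normal_conj.
have E2 : nrm2 E <= n.+1%:R * f ^+ 2.
  rewrite /E -mulmxA nrm2_isometry // -nrm2_ctr ctrM ctrK nrm2_isometry // nrm2_ctr.
  exact: opb_frob.
have AP : A *m P = P *m D by rewrite /A -mulmxA Po mulmx1.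
clearbody T A E.
pose Lam := diag_mx (\row_i T i i).
have ALij i j : (A - Lam) i j = A i j - (T i i) *+ (i == j).
  by rewrite !mxE.
have TEij i j : T i j = A i j + E i j by rewrite TE mxE.
have AL : nrm2 (A - Lam) <= n.+1%:R * nrm2 E.
  have lower : \sum_(i < n.+1) \sum_(j < n.+1 | (j < i)%N) cabs (A i j) ^+ 2
      <= n%:R * \sum_(i < n.+1) \sum_(j < n.+1 | (i < j)%N) cabs (A i j) ^+ 2.
    have := @normal_upper_le_lower n (ctr A); rewrite ctrK => /(_ (esym An)).
    rewrite (exchange_big_dep predT) //= [X in _ <= _ * X](exchange_big_dep predT) //=.
    under eq_bigr do under eq_bigr do rewrite ctrE cabs_conj.
    by under [X in _ <= _ * X]eq_bigr do under eq_bigr do rewrite ctrE cabs_conj.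
  rewrite /nrm2 !sum_diag_upper_lower.
  have offdiag (i j : 'I_n.+1) : i != j -> (A - Lam) i j = A i j.
    by move=> ij; rewrite ALij (negbTE ij) mulr0n subr0.
  have -> : \sum_(i < n.+1) cabs ((A - Lam) i i) ^+ 2 = \sum_i cabs (E i i) ^+ 2.
    apply: eq_bigr => i _; congr (_ ^+ 2); rewrite -cabsN; congr cabs.
    by rewrite ALij eqxx mulr1n TEij opprB addrC addKr.
  have -> : \sum_(i < n.+1) \sum_(j < n.+1 | (i < j)%N) cabs ((A - Lam) i j) ^+ 2
          = \sum_(i < n.+1) \sum_(j < n.+1 | (i < j)%N) cabs (A i j) ^+ 2.
    apply: eq_bigr => i _; apply: eq_bigr => j ij; rewrite offdiag //.
    by apply: contraTneq ij => ->; rewrite ltnn.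
  have -> : \sum_(i < n.+1) \sum_(j < n.+1 | (j < i)%N) cabs ((A - Lam) i j) ^+ 2
          = \sum_(i < n.+1) \sum_(j < n.+1 | (j < i)%N) cabs (A i j) ^+ 2.
    apply: eq_bigr => i _; apply: eq_bigr => j ij; rewrite offdiag //.
    by apply: contraTneq ij => ->; rewrite ltnn.
  have -> : \sum_(i < n.+1) \sum_(j < n.+1 | (i < j)%N) cabs (E i j) ^+ 2
          = \sum_(i < n.+1) \sum_(j < n.+1 | (i < j)%N) cabs (A i j) ^+ 2.
    apply: eq_bigr => i _; apply: eq_bigr => j ij; congr (_ ^+ 2); rewrite -[RHS]cabsN.
    congr cabs; apply/eqP; rewrite -addr_eq0 addrC -TEij.
    by apply/eqP/(is_trig_mxP Ttrig).
  move: lower; set l := \sum_i _; set u := \sum_i _; set d := \sum_i _; set l' := \sum_i _.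
  have d0 : 0 <= d by apply: sumr_ge0 => *; exact: sqr_ge0.
  have u0 : 0 <= u by do 2!apply: sumr_ge0 => *; exact: sqr_ge0.
  have l0 : 0 <= l' by do 2!apply: sumr_ge0 => *; exact: sqr_ge0.
  move=> lu; rewrite -natr1; have n0 : 0 <= n%:R :> R by [].
  have : 0 <= n%:R * (d + l') by rewrite mulr_ge0 // addr_ge0.
  by lra.
have rowP i : \sum_k cabs (P i k) ^+ 2 = 1.
  have := congr1 (fun M : 'M[C]_n.+1 => M i i) Pc; rewrite ctrK !mxE eqxx => e.
  apply: (@complexI R); rewrite rmorph_sum -[RHS]e; apply: eq_bigr => k _.
  by rewrite /= cabs_sqrC ctrE mulrC.
have colP k : \sum_i cabs (P i k) ^+ 2 = 1.
  have := congr1 (fun M : 'M[C]_n.+1 => M k k) Po; rewrite !mxE eqxx => e.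
  apply: (@complexI R); rewrite rmorph_sum -[RHS]e; apply: eq_bigr => i _.
  by rewrite /= cabs_sqrC ctrE.
have cost : \sum_i \sum_k cabs (P i k) ^+ 2 * cabs (z k - T i i) ^+ 2
    <= (n.+1%:R * f) ^+ 2.
  have -> : \sum_i \sum_k cabs (P i k) ^+ 2 * cabs (z k - T i i) ^+ 2
      = nrm2 ((A - Lam) *m P).
    apply: eq_bigr => i _; apply: eq_bigr => k _.
    rewrite mulmxBl AP mul_mx_diag mul_diag_mx !mxE.
    by rewrite [T i i * _]mulrC -mulrBr cabsM exprMn.
  rewrite -nrm2_ctr ctrM nrm2_isometry // nrm2_ctr; apply: le_trans AL _.
  by rewrite exprMn expr2 -mulrA ler_wpM2l.
have [||p pc] := bistochastic_matching _ _ rowP colP cost.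
- by move=> i k; exact: sqr_ge0.
- by move=> i k; exact: sqr_ge0.
exists (p^-1 * s)%g => k; rewrite permM -sE -cabsN opprB.
have := pc (p^-1 k)%g; rewrite permKV.
by rewrite ler_pXn2r ?nnegrE ?cabs_ge0 // mulr_ge0.
Qed.

End Sun.

Section Perturbation.
Variable R : rcfType.
Local Notation C := R[i].

Lemma diagR_ctr m n (s : nat -> R) : ctr (diagR m n s) = diagR n m s.
Proof.
apply/matrixP => i j; rewrite ctrE !mxE eq_sym; case: eqP => [->|_].
  exact: conjc_real.
exact: conjc0.
Qed.

Lemma svd_ctr m n (A : 'M[C]_(m, n)) U s V : is_svd A U s V -> is_svd (ctr A) V s U.
Proof.
case=> [[Uo Vo] sdec s0 sz ->]; split=> //; try by rewrite minnC.
by rewrite !ctrM ctrK diagR_ctr mulmxA.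
Qed.

Lemma firstcolsE m n k (A : 'M[C]_(m, n)) :
  firstcols k A = A *m diagR n k (fun=> 1).
Proof.
apply/matrixP => i j; rewrite !mxE big_mkcond /=; apply: eq_bigr => l _.
by rewrite mxE; case: eqP; rewrite ?mulr1 ?mulr0.
Qed.

Lemma diagR_mul m n k (s t : nat -> R) : (k <= n)%N ->
  diagR m n s *m diagR n k t = diagR m k (fun i => s i * t i).
Proof.
move=> kn; apply/matrixP => i j; rewrite !mxE.
rewrite (bigD1 (widen_ord kn j)) //= !mxE /= eqxx big1 ?addr0 => [|l lj].
  by case: eqP => [->|_]; rewrite ?mul0r ?rmorphM.
rewrite !mxE; case: (eqVneq (l : nat) j) => [e|_]; last by rewrite mulr0.
by case/eqP: lj; exact: val_inj.
Qed.

Lemma diagR_mull m n k (s t : nat -> R) : (k <= n)%N -> (k <= m)%N ->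
  diagR m n s *m diagR n k t = diagR m k t *m diagR k k s.
Proof.
move=> kn km; rewrite !diagR_mul //.
by apply/matrixP => i j; rewrite !mxE mulrC.
Qed.

Lemma diagR1 n : diagR n n (fun=> 1) = 1%:M :> 'M[C]_n.
Proof. by apply/matrixP => i j; rewrite !mxE -val_eqE /=; case: eqP. Qed.

Lemma firstcols_ortho m k (U : 'M[C]_m) : (k <= m)%N ->
  orthonormal_cols U -> orthonormal_cols (firstcols k U).
Proof.
move=> km Uo; rewrite /orthonormal_cols firstcolsE ctrM diagR_ctr mulmxA.
rewrite -(mulmxA (diagR _ _ _)) Uo mulmx1 diagR_mul //.
by rewrite -[RHS]diagR1; apply/matrixP => i j; rewrite !mxE mulr1.
Qed.

Lemma svd_firstcols m n k (A : 'M[C]_(m, n)) U s V : is_svd A U s V ->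
  (k <= m)%N -> (k <= n)%N ->
  A *m firstcols k V = firstcols k U *m diagR k k s.
Proof.
move=> [[Uo Vo] _ _ _ ->] km kn; rewrite !firstcolsE !mulmxA.
rewrite -(mulmxA (U *m _) (ctr V)) Vo mulmx1 -!mulmxA.
by rewrite diagR_mull.
Qed.

Lemma orthonormal_factor m n (A : 'M[C]_(m, n)) : (n <= m)%N ->
  (forall x : 'cV[C]_n, A *m x = 0 -> x = 0) ->
  exists (S : 'M[C]_(m, n)) (G : 'M[C]_n), orthonormal_cols S /\ A = S *m G.
Proof.
move=> nm Ainj; have [U [s [V As]]] := svd_exists_tall nm Ainj.
have [[Uo Vo] _ _ _ _] := As.
exists (firstcols n U), (diagR n n s *m ctr V); split; first exact: firstcols_ortho.
rewrite mulmxA -(svd_firstcols As) // firstcolsE diagR1 mulmx1 -mulmxA.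
by rewrite (mulmx1C Vo) mulmx1.
Qed.

Lemma wide_kernel k (M : 'M[C]_(k, k.+1)) : exists2 y : 'cV[C]_k.+1, y != 0 & M *m y = 0.
Proof.
have : kermx M^T != 0.
  rewrite -mxrank_eq0 mxrank_ker -lt0n subn_gt0 mxrank_tr ltnS.
  exact: rank_leq_row.
move=> /rowV0Pn[v /sub_kermxP vM v0]; exists v^T; last first.
  by rewrite -[M]trmxK -trmx_mul vM trmx0.
by apply: contra v0 => /eqP/(congr1 trmx); rewrite trmxK trmx0 => ->.
Qed.

(* Courant-Fischer with the test space [range (ctr B)], on which X is bounded below. *)
Lemma weyl_lower m n k (A : 'M[C]_(m, k.+1)) (D : 'M[C]_k.+1) (B : 'M[C]_(k.+1, n))
    (E : 'M[C]_(m, n)) U s W a d b eps :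
  (k < m)%N -> (k < n)%N -> 0 <= a -> 0 <= d -> 0 < b ->
  lob A a -> lob D d -> lob (ctr B) b -> opb E eps ->
  is_svd (A *m D *m B + E) U s W -> a * d * b - eps <= s k.
Proof.
move=> km kn a0 d0 b0 Aa Dd Bb Ee Xs.
have [y y0 My] := wide_kernel (\matrix_(i < k, j < k.+1)
  (ctr W *m ctr B) (widen_ord (ltnW kn) i) j).
pose x := ctr B *m y.
have x0 : 0 < nrm x by apply: lt_le_trans (Bb y); rewrite mulr_gt0 // nrm_gt0.
have Wx (i : 'I_n) : (i < k)%N -> (ctr W *m x) i 0 = 0.
  move=> ik; rewrite /x mulmxA.
  have /matrixP /(_ (Ordinal ik) 0) := My; rewrite !mxE => h; rewrite -[RHS]h.
  apply: eq_bigr => j _; rewrite mxE; congr (_ * _); congr (fun_of_matrix _ _ j).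
  exact: val_inj.
have [[Uo Wo] sdec s0 _ _] := Xs.
have kmn : (k < minn m n)%N by rewrite leq_min km.
have up : nrm ((A *m D *m B + E) *m x) <= s k * nrm x.
  rewrite -(@ler_pXn2r _ 2) ?nnegrE ?mulr_ge0 ?nrm_ge0 ?s0 //.
  rewrite exprMn !nrm_sqr (svd_nrm2 _ Xs).
  rewrite -(nrm2_isometry x (orthonormal_ctr Wo)) nrm2_cV mulr_sumr.
  apply: ler_sum => j _; have [jk|kj] := ltnP j k.
    by rewrite Wx // cabs0 expr0n /= !mulr0 lexx.
  apply: ler_wpM2r; first exact: sqr_ge0.
  have [jm|mj] := ltnP j m.
    have jmn : (j < minn m n)%N by rewrite leq_min jm ltn_ord.
    by apply: lerXn2r; rewrite ?nnegrE ?s0 ?sdec.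
  have [_ _ _ -> //] := Xs; first by rewrite expr0n sqr_ge0.
  exact: leq_trans (geq_minl _ _) mj.
have Bx : b * nrm x <= nrm (B *m x).
  rewrite -(ler_pM2r x0) -mulrA -expr2 nrm_sqr nrm2_Re {1}/x ctrM ctrK -mulmxA.
  apply: (@le_trans _ _ (b * (nrm y * nrm (B *m x)))).
    by rewrite ler_pM2l // Re_tr_le.
  by rewrite mulrA [leRHS]mulrC ler_wpM2r ?nrm_ge0.
have low : (a * d * b - eps) * nrm x <= nrm ((A *m D *m B + E) *m x).
  rewrite mulmxDl; apply: le_trans (lerB_nrmD _ _); rewrite mulrBl; apply: lerB (Ee x).
  rewrite -!mulmxA; apply: le_trans (Aa _); rewrite -!mulrA ler_wpM2l //.
  by apply: le_trans (Dd _); rewrite ler_wpM2l.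
by have := le_trans low up; rewrite ler_pM2r.
Qed.

Lemma nrm2_pythagoras m n p (S : 'M[C]_(m, n)) (X : 'M[C]_(m, p)) :
  orthonormal_cols S ->
  nrm2 X = nrm2 (ctr S *m X) + nrm2 (X - S *m (ctr S *m X)).
Proof.
move=> So; rewrite nrm2B (nrm2_isometry _ So) mulmxA.
have -> : Re (\tr (ctr X *m S *m (ctr S *m X))) = nrm2 (ctr S *m X).
  by rewrite nrm2_Re ctrM ctrK.
by ring.
Qed.

Lemma lob_diagR k (s : nat -> R) c : 0 < c -> (forall i, (i < k)%N -> c <= s i) ->
  lob (diagR k k s) c.
Proof.
move=> c0 cs x; have s0 i : (i < k)%N -> 0 <= s i by move/cs; exact/le_trans/ltW.
rewrite -(@ler_pXn2r _ 2) ?nnegrE ?mulr_ge0 ?nrm_ge0 ?(ltW c0) // exprMn !nrm_sqr.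
pose s' i := if (i < k)%N then s i else 0.
have -> : diagR k k s = diagR k k s' by apply/matrixP => i j; rewrite !mxE /s' ltn_ord.
rewrite nrm2_diagR => [|i]; last by rewrite /s' ltnNge => ->.
rewrite [nrm2 x]nrm2_cV mulr_sumr; apply: ler_sum => i _.
apply: ler_wpM2r; first exact: sqr_ge0.
by rewrite /s' ltn_ord; apply: lerXn2r; rewrite ?nnegrE ?s0 ?cs ?(ltW c0).
Qed.

Lemma singular_subspace_angle m n k (S : 'M[C]_(m, k)) (Y : 'M[C]_(k, n)) E U s W eps eta :
  (0 < k)%N -> (k <= m)%N -> (k <= n)%N -> orthonormal_cols S ->
  opb E eps -> is_svd (S *m Y + E) U s W ->
  0 < s k.-1 -> eps <= eta * s k.-1 ->
  opb (firstcols k U - S *m (ctr S *m firstcols k U)) eta.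
Proof.
move=> k0 km kn So Ee Xs sk es x.
have sv := svd_firstcols Xs km kn.
have [[Uo Wo] sdec _ _ _] := Xs.
have kmn : (k <= minn m n)%N by rewrite leq_min km.
have Sl : lob (diagR k k s) (s k.-1).
  apply: lob_diagR => // i ik; apply: sdec; first by rewrite -ltnS prednK.
  by rewrite (leq_trans _ kmn) // prednK.
have Su := lob_unit sk Sl.
have e0 : 0 <= eps.
  by apply: opb_ge0 Ee; exact: leq_trans k0 kn.
pose y := invmx (diagR k k s) *m x.
have -> : x = diagR k k s *m y by rewrite mulKVmx.
rewrite mulmxBl -!mulmxA !(mulmxA (firstcols k U)) -sv.
set Z := (S *m Y + E) *m firstcols k W.
have -> : Z *m y - S *m (ctr S *m (Z *m y))
   = E *m (firstcols k W *m y) - S *m (ctr S *m (E *m (firstcols k W *m y))).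
  rewrite /Z -!mulmxA mulmxDl !mulmxDr -!mulmxA !(mulmxA (ctr S) S) So mul1mx.
  by rewrite opprD addrACA subrr add0r.
set v := E *m _; apply: (@le_trans _ _ (nrm v)).
  rewrite -(@ler_pXn2r _ 2) ?nnegrE ?nrm_ge0 // !nrm_sqr (nrm2_pythagoras v So).
  by rewrite lerDr nrm2_ge0.
apply: le_trans (Ee _) _; rewrite nrm_isometry; last exact: firstcols_ortho.
apply: (@le_trans _ _ (eta * s k.-1 * nrm y)); first by rewrite ler_wpM2r ?nrm_ge0.
rewrite -mulrA ler_wpM2l //; have := le_trans e0 es; rewrite pmulr_lge0 //.
Qed.

Lemma lob_angle m k (S T : 'M[C]_(m, k)) eta : orthonormal_cols S -> orthonormal_cols T ->
  opb (T - S *m (ctr S *m T)) eta -> 0 <= eta -> eta <= 1 ->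
  lob (ctr S *m T) (Num.sqrt (1 - eta ^+ 2)).
Proof.
move=> So To ST eta0 eta1 x.
have e1 : 0 <= 1 - eta ^+ 2 by rewrite subr_ge0 expr_le1.
rewrite -(@ler_pXn2r _ 2) ?nnegrE ?mulr_ge0 ?nrm_ge0 ?sqrtr_ge0 //.
rewrite exprMn sqr_sqrtr // !nrm_sqr mulrBl mul1r lerBlDr.
rewrite -[X in X <= _](nrm2_isometry x To) (nrm2_pythagoras (T *m x) So) mulmxA lerD2l.
by have := opb_nrm2 x ST; rewrite mulmxBl -(mulmxA S).
Qed.

Lemma polar_unitary k (M : 'M[C]_k) c : 0 < c -> lob M c ->
  exists2 Q : 'M[C]_k, orthonormal_cols Q &
    forall x : 'cV[C]_k, c * nrm2 x <= Re (\tr (ctr (M *m x) *m (Q *m x))).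
Proof.
move=> c0 Mc; have Minj (x : 'cV[C]_k) : M *m x = 0 -> x = 0.
  by move=> Mx; rewrite -[x](mulKmx (lob_unit c0 Mc)) Mx mulmx0.
have [U [s [V Ms]]] := svd_exists_tall (leqnn k) Minj.
have [[Uo Vo] _ _ _ ME] := Ms.
exists (U *m ctr V) => [|x].
  by rewrite /orthonormal_cols ctrM ctrK mulmxA -(mulmxA V) Uo mulmx1 (mulmx1C Vo).
rewrite {1}ME -!mulmxA ctrM -(mulmxA _ (ctr U)) (mulmxA (ctr U)) Uo mul1mx.
rewrite -(nrm2_isometry x (orthonormal_ctr Vo)) nrm2_cV mulr_sumr.
set y := ctr V *m x; rewrite ctrM diagR_ctr -mulmxA /mxtrace big_ord1 mxE raddf_sum.
apply: ler_sum => j _; rewrite ctrE.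
have -> : (diagR k k s *m y) j 0 = (s j)%:C%C * y j 0.
  rewrite mxE (bigD1 j) //= mxE eqxx big1 ?addr0 // => i ij.
  by rewrite mxE; case: eqP => [e|_]; [case/eqP: ij; exact/esym/val_inj | rewrite mul0r].
rewrite -[leRHS]/(Re _) [X in Re X]mulrCA ReM_real -cabs_sqr ler_wpM2r ?sqr_ge0 //.
exact: svd_sv_ge Ms _ Mc.
Qed.

Lemma aligned_basis m k (S T : 'M[C]_(m, k)) eta : orthonormal_cols S -> orthonormal_cols T ->
  opb (T - S *m (ctr S *m T)) eta -> 0 <= eta -> eta < 1 ->
  exists2 Q : 'M[C]_k, orthonormal_cols Q & opb (T - S *m Q) (Num.sqrt 2 * eta).
Proof.
move=> So To ST eta0 eta1; have M := lob_angle So To ST eta0 (ltW eta1).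
set c := Num.sqrt _ in M.
have e1 : 0 < 1 - eta ^+ 2 by rewrite subr_gt0 expr_lt1.
have c0 : 0 < c by rewrite sqrtr_gt0.
have c2 : c ^+ 2 = 1 - eta ^+ 2 by rewrite sqr_sqrtr // ltW.
have [Q Qo Qc] := polar_unitary c0 M; exists Q => // x.
rewrite -(@ler_pXn2r _ 2) ?nnegrE ?mulr_ge0 ?nrm_ge0 ?sqrtr_ge0 //.
rewrite !exprMn !nrm_sqr sqr_sqrtr // mulmxBl nrm2B -!mulmxA.
rewrite (nrm2_isometry _ To) (nrm2_isometry _ So) (nrm2_isometry _ Qo).
have -> : ctr (T *m x) *m (S *m (Q *m x)) = ctr ((ctr S *m T) *m x) *m (Q *m x).
  by rewrite -mulmxA !ctrM ctrK -!mulmxA.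
have := Qc x; have := nrm2_ge0 x.
have : 1 - c <= eta ^+ 2.
  have : eta ^+ 2 = (1 - c) * (1 + c) by rewrite -subr_sqr expr1n c2; ring.
  have : c <= 1 by rewrite -(@ler_pXn2r _ 2) ?nnegrE ?(ltW c0) // c2 expr1n gerBl sqr_ge0.
  by nra.
by set t := Re _; nra.
Qed.

End Perturbation.

Section Pencils.
Variable R : rcfType.
Local Notation C := R[i].

Lemma pencil_polyM n (P A B : 'M[C]_n) :
  pencil_poly (P *m A) (P *m B) = (\det P)%:P * pencil_poly A B.
Proof.
rewrite /pencil_poly !map_mxM scalemxAr -mulmxBr det_mulmx.
by rewrite det_map_mx.
Qed.

Lemma pencil_poly1 n (M : 'M[C]_n) :
  pencil_poly 1%:M M = (-1) ^+ n * char_poly M.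
Proof.
rewrite /pencil_poly /char_poly -detZ scaleN1r /char_poly_mx opprB; congr (\det (_ - _)).
by rewrite map_mx1 scalemx1.
Qed.

Lemma gen_eigvals_finite n (A B : 'M[C]_n) (zh : 'I_n -> option C) :
  A \in unitmx -> gen_eigvals_mult A B zh ->
  exists w : 'I_n -> C, (forall k, zh k = Some (w k)) /\
    char_poly (invmx A *m B) = \prod_k ('X - (w k)%:P).
Proof.
move=> Au [c [c0 e]].
pose f k : {poly C} := if zh k is Some w then 'X - w%:P else 1.
have fm k : f k \is monic by rewrite /f; case: (zh _) => [w|]; [exact: monicXsubC | exact: monic1].
have pm : \prod_k f k \is monic by rewrite monic_prod.
have {e} e : char_poly (invmx A *m B) = \prod_k f k.
  have e2 : char_poly (invmx A *m B) = (-1) ^+ n * ((\det A)^-1%:P * (c *: \prod_k f k)).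
    rewrite -e -[X in pencil_poly X _]mulmx1 -[X in pencil_poly _ X](mulKVmx Au).
    rewrite pencil_polyM [X in _ * X]mulrA -polyCM mulVf ?mul1r -?unitfE -?unitmxE //.
    by rewrite pencil_poly1 mulrA -exprD addnn -mul2n exprM sqrrN !expr1n mul1r.
  have e3 : char_poly (invmx A *m B) = ((-1) ^+ n * (\det A)^-1 * c) *: \prod_k f k.
    by rewrite e2 -!mul_polyC !polyCM rmorphXn rmorphN1 !mulrA.
  have /monicP := char_poly_monic (invmx A *m B).
  by rewrite e3 lead_coefZ (monicP pm) mulr1 => ->; rewrite scale1r.
have all_some k : zh k != None.
  apply/eqP => zk; have := size_char_poly (invmx A *m B); rewrite e (bigD1 k) //=.
  rewrite {1}/f zk mul1r size_prod => [|i _]; last exact: monic_neq0.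
  rewrite cardC1 card_ord => sz.
  have : (\sum_(i < n | i != k) size (f i) <= \sum_(i < n | i != k) 2)%N.
    apply: leq_sum => i _; rewrite /f; case: (zh _) => [w|]; first by rewrite size_XsubC.
    by rewrite size_polyC oner_eq0.
  rewrite sum_nat_const cardC1 card_ord => le; have := ltn_ord k; move: sz le.
  move: (\sum_(i < n | _) _)%N => u; lia.
exists (fun k => odflt 0 (zh k)); split=> [k|].
  by case: (zh k) (all_some k).
rewrite e; apply: eq_bigr => k _; rewrite /f.
by case: (zh k) (all_some k).
Qed.

Lemma opb_diag n (a : 'I_n -> C) c : (forall k, cabs (a k) <= c) -> 0 <= c ->
  opb (diag_mx (\row_k a k)) c.
Proof.
move=> ac c0 x; rewrite -(@ler_pXn2r _ 2) ?nnegrE ?mulr_ge0 ?nrm_ge0 //.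
rewrite exprMn !nrm_sqr !nrm2_cV mulr_sumr; apply: ler_sum => i _.
rewrite mul_diag_mx !mxE cabsM exprMn ler_wpM2r ?sqr_ge0 //.
by apply: lerXn2r; rewrite ?nnegrE ?cabs_ge0.
Qed.

Lemma lob_diag n (a : 'I_n -> C) c : (forall k, c <= cabs (a k)) -> 0 <= c ->
  lob (diag_mx (\row_k a k)) c.
Proof.
move=> ac c0 x; rewrite -(@ler_pXn2r _ 2) ?nnegrE ?mulr_ge0 ?nrm_ge0 //.
rewrite exprMn !nrm_sqr !nrm2_cV mulr_sumr; apply: ler_sum => i _.
rewrite mul_diag_mx !mxE cabsM exprMn ler_wpM2r ?sqr_ge0 //.
by apply: lerXn2r; rewrite ?nnegrE ?cabs_ge0.
Qed.

Lemma lob_perturb m n (A E : 'M[C]_(m, n)) c e : lob A c -> opb E e -> lob (A + E) (c - e).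
Proof.
move=> Ac Ee x; rewrite mulmxDl mulrBl; apply: le_trans (lerB_nrmD _ _).
exact: lerB.
Qed.

Lemma pencil_perturbation n (z : 'I_n.+1 -> C) (A B D N1 N2 : 'M[C]_n.+1) a b d eps g
    (zh : 'I_n.+1 -> option C) :
  let Z := diag_mx (\row_k z k) in
  (forall k, cabs (z k) <= 1) ->
  0 < a -> 0 < b -> 0 < d -> lob A a -> lob B b -> lob D d ->
  opb N1 eps -> opb N2 eps -> eps <= g * (a * d * b) -> g < 1 ->
  gen_eigvals_mult (A *m D *m B + N1) (A *m D *m Z *m B + N2) zh ->
  exists p : 'S_n.+1, forall k, exists2 w, zh (p k) = Some w &
    cabs (w - z k) <= n.+1%:R * (2 * g / (1 - g)).
Proof.
move=> Z z1 a0 b0 d0 Aa Bb Dd N1e N2e eg g1.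
have eps0 : 0 <= eps by exact: opb_ge0 N1e.
have g0 : 0 <= g by have := le_trans eps0 eg; rewrite pmulr_lge0 ?mulr_gt0.
have ADl : lob (A *m D) (a * d) by apply: lobM => //; exact: ltW.
have ad0 : 0 < a * d by rewrite mulr_gt0.
have ADu := lob_unit ad0 ADl; have Bu := lob_unit b0 Bb.
pose conj N := invmx (A *m D) *m N *m invmx B.
have conj_opb N : opb N eps -> opb (conj N) g.
  move=> Ne; apply: (@opb_le _ _ _ _ ((a * d)^-1 * eps * b^-1)).
    rewrite mulrC mulrA -invfM ler_pdivrMl ?mulr_gt0 //.
    by rewrite mulrC [b * _]mulrC.
  have ad0' : 0 <= (a * d)^-1 by rewrite invr_ge0 ltW.
  apply: opbM; [by rewrite mulr_ge0 | apply: opbM => //; exact: lob_inv | exact: lob_inv].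
have conjK N : (A *m D) *m conj N *m B = N.
  by rewrite /conj !mulmxA mulmxKV // mulmxV // mul1mx.
have G1 := conj_opb _ N1e; have G2 := conj_opb _ N2e.
clearbody conj; set H1 := 1%:M + conj N1.
have H1l : lob H1 (1 - g) by apply: lob_perturb G1 => x; rewrite mul1mx mul1r.
have g1' : 0 < 1 - g by rewrite subr_gt0.
have H1u := lob_unit g1' H1l.
have -> : A *m D *m B + N1 = A *m D *m H1 *m B.
  by rewrite /H1 mulmxDr mulmx1 mulmxDl conjK.
have -> : A *m D *m Z *m B + N2 = A *m D *m (Z + conj N2) *m B.
  by rewrite mulmxDr mulmxDl conjK.
pose F := invmx H1 *m (conj N2 - conj N1 *m Z).
have FE : Z + conj N2 = H1 *m (Z + F).
  rewrite mulmxDr /F mulKVmx // /H1 mulmxDl mul1mx.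
  by rewrite addrACA subrr addr0.
have Ff : opb F (2 * g / (1 - g)).
  have -> : 2 * g / (1 - g) = (1 - g)^-1 * (g + g * 1) by rewrite mulr1 mulrC; congr (_ * _); ring.
  apply: opbM; [by rewrite invr_ge0 ltW | exact: lob_inv |].
  apply: opbD => //; apply: opbN; apply: opbM => //; exact: opb_diag.
have P1u : A *m D *m H1 *m B \in unitmx.
  by rewrite unitmx_mul Bu andbT unitmx_mul ADu.
clearbody H1 F.
move=> /(gen_eigvals_finite P1u) [w [zw]].
have -> : A *m D *m (Z + conj N2) *m B = A *m D *m H1 *m B *m (invmx B *m (Z + F) *m B).
  by rewrite FE !mulmxA mulmxK.
rewrite mulKmx // -[X in _ *m X]invmxK char_poly_conj ?unitmx_inv //.
move=> /(spectral_variation_normal Ff) [p pP].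
by exists p => k; exists (w (p k)).
Qed.

Lemma shift_perturbation m q n (Jd Ju : 'M[C]_(q, m)) (V S T : 'M[C]_(m, n.+1))
    (G Q Phi : 'M[C]_n.+1) (z w : 'I_n.+1 -> C) smin smax sd delta :
  (forall k, cabs (z k) <= 1) -> opb Jd 1 -> opb Ju 1 ->
  0 < smin -> 0 < smax -> 0 < sd -> lob V smin -> opb V smax -> lob (Jd *m V) sd ->
  Ju *m V = Jd *m V *m diag_mx (\row_k z k) ->
  orthonormal_cols S -> V = S *m G -> orthonormal_cols Q -> opb (T - S *m Q) delta ->
  delta * (smax / sd) < 1 ->
  Jd *m T *m Phi = Ju *m T -> char_poly Phi = \prod_k ('X - (w k)%:P) ->
  exists p : 'S_n.+1, forall k, cabs (w (p k) - z k) <=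
    n.+1%:R * ((smax / smin) * ((sd / smax - delta)^-1 * (delta * (1 + smax / smin)))).
Proof.
move=> z1 Jd1 Ju1 smin0 smax0 sd0 Vmin Vmax Vd shift So VE Qo Td small PhiE Phiw.
set Z := diag_mx _ in shift; set kap := smax / smin.
have d0 : 0 <= delta by exact: opb_ge0 Td.
pose S' := S *m Q; pose G' := ctr Q *m G.
have So' (x : 'cV[C]_n.+1) : nrm (S' *m x) = nrm x by rewrite -mulmxA !nrm_isometry.
have VE' : V = S' *m G'.
  by rewrite /S' /G' -mulmxA (mulmxA Q) (mulmx1C Qo) mul1mx.
rewrite -[S *m Q]/S' in Td; clearbody S' G'.
have Gmin : lob G' smin by move=> x; rewrite -[X in _ <= X]So' mulmxA -VE'.
have Gmax : opb G' smax by move=> x; rewrite -[X in X <= _]So' mulmxA -VE'.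
have Gu := lob_unit smin0 Gmin.
have Ginv := lob_inv smin0 Gmin.
pose Phi0 := G' *m Z *m invmx G'.
have Phi0k : opb Phi0 kap.
  have -> : kap = smax * 1 * smin^-1 by rewrite mulr1.
  apply: opbM => //; first by rewrite mulr1 ltW.
  by apply: opbM => //; [exact: ltW | exact: opb_diag].
have Sd : lob (Jd *m S') (sd / smax).
  move=> x; rewrite -[x](mulKVmx Gu); move: (invmx G' *m x) => y.
  rewrite mulmxA -(mulmxA Jd) -VE'.
  apply: le_trans (Vd _); rewrite -mulrA ler_pM2l // mulrC ler_pdivrMr // mulrC.
  exact: Gmax.
have Phi0E : Jd *m S' *m Phi0 = Ju *m S'.
  rewrite /Phi0 !mulmxA -(mulmxA Jd) -VE' -shift VE' -!mulmxA mulmxV //.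
  by rewrite mulmx1.
pose Del := T - S'.
have Tl : lob (Jd *m T) (sd / smax - delta).
  have -> : Jd *m T = Jd *m S' + Jd *m Del by rewrite -mulmxDr addrC subrK.
  by apply: lob_perturb => //; rewrite -[delta]mul1r; apply: opbM.
have gap : 0 < sd / smax - delta.
  by rewrite subr_gt0 ltr_pdivlMr //; move: small; rewrite mulrA ltr_pdivrMr // mul1r.
have diffE : Jd *m T *m (Phi - Phi0) = Ju *m Del - Jd *m Del *m Phi0.
  rewrite mulmxBr PhiE /Del !mulmxBr mulmxBl Phi0E.
  by rewrite opprB addrA subrK.
have diff : opb (Phi - Phi0) ((sd / smax - delta)^-1 * (delta * (1 + kap))).
  move=> x; rewrite -mulrA mulrC ler_pdivlMr // mulrC.
  apply: le_trans (Tl _) _; rewrite mulmxA diffE.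
  have -> : delta * (1 + kap) = 1 * delta + 1 * delta * kap by ring.
  by apply: opbD; [apply: opbM | apply: opbN; apply: opbM => //; [rewrite mul1r | apply: opbM]].
pose F := invmx G' *m (Phi - Phi0) *m G'.
have FE : invmx G' *m Phi *m G' = Z + F.
  by rewrite /F mulmxBr mulmxBl addrCA /Phi0 !mulmxA mulVmx // mul1mx mulmxKV // subrr addr0.
have Ff : opb F (kap * ((sd / smax - delta)^-1 * (delta * (1 + kap)))).
  have -> : kap * ((sd / smax - delta)^-1 * (delta * (1 + kap))) =
    smin^-1 * ((sd / smax - delta)^-1 * (delta * (1 + kap))) * smax.
    by rewrite /kap; ring.
  have kap0 : 0 <= kap by rewrite divr_ge0 ?ltW.
  apply: opbM => //.
    rewrite mulr_ge0 ?invr_ge0 ?(ltW smin0) // mulr_ge0 ?invr_ge0 ?(ltW gap) //.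
    by rewrite mulr_ge0 // addr_ge0.
  by apply: opbM => //; rewrite invr_ge0 ltW.
apply: (spectral_variation_normal Ff); rewrite -/Z -FE -Phiw.
by rewrite -[X in _ *m X]invmxK char_poly_conj ?unitmx_inv.
Qed.

End Pencils.

Section Hankel.
Variable R : rcfType.
Local Notation C := R[i].

Lemma hankelD L M (x y : nat -> C) :
  hankel L M (fun n => x n + y n) = hankel L M x + hankel L M y.
Proof. by apply/matrixP => i j; rewrite !mxE. Qed.

Lemma hankel_vander K L M (z c : 'I_K -> C) :
  hankel L M (fun n => \sum_k c k * z k ^+ n) =
  vander z L *m diag_mx (\row_k c k) *m (vander z (M - L).+1)^T.
Proof.
apply/matrixP => i j; rewrite !mxE; apply: eq_bigr => k _.
by rewrite mul_mx_diag !mxE exprD mulrCA mulrA.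
Qed.

Lemma sum_shift_le (a : nat -> R) i p N : (forall n, 0 <= a n) -> (i + p <= N)%N ->
  \sum_(j < p) a (i + j)%N <= \sum_(n < N) a n.
Proof.
move=> a0 ipN.
rewrite -(big_mkord predT (fun j => a (i + j)%N)) -(big_mkord predT a) /=.
rewrite [leRHS](@big_cat_nat _ _ _ i) //=; last by apply: leq_trans ipN; exact: leq_addr.
rewrite [X in _ <= _ + X](@big_cat_nat _ _ _ (i + p)%N) //=; last exact: leq_addr.
have -> : \sum_(0 <= j < p) a (i + j)%N = \sum_(i <= n < i + p) a n.
  have := big_addn 0 (i + p) i predT a; rewrite add0n addKn => ->.
  by apply: eq_bigr => j _; rewrite addnC.
rewrite addrCA lerDl addr_ge0 //; exact: sumr_ge0.
Qed.

Lemma hankel_nrm2 L M (y : nat -> C) : (0 < L)%N -> (L <= M)%N ->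
  nrm2 (hankel L M y) <= (minn L (M - L).+1)%:R * \sum_(n < M) cabs (y n) ^+ 2.
Proof.
move=> L0 LM; pose a n := cabs (y n) ^+ 2; have a0 n : 0 <= a n by exact: sqr_ge0.
have -> : nrm2 (hankel L M y) = \sum_(i < L) \sum_(j < (M - L).+1) a (i + j)%N.
  by apply: eq_bigr => i _; apply: eq_bigr => j _; rewrite mxE.
rewrite /minn; case: ifP => _.
  rewrite -[X in X%:R * _]card_ord -sumr_const mulr_suml; apply: ler_sum => i _.
  rewrite mul1r; apply: sum_shift_le => //; have := ltn_ord i; lia.
rewrite exchange_big -[X in X%:R * _]card_ord -sumr_const mulr_suml; apply: ler_sum => j _.
rewrite mul1r; under eq_bigr do rewrite addnC.
apply: sum_shift_le => //; have := ltn_ord j; lia.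
Qed.

Lemma opb_hankel L M N m (y e : nat -> C) : (0 < L)%N -> (L <= M)%N ->
  m = minn L (M - L).+1 ->
  \sum_(n < M) cabs (y n) ^+ 2 <= \sum_(n < N) cabs (e n) ^+ 2 ->
  opb (hankel L M y) (Num.sqrt m%:R * vnorm N e).
Proof.
move=> L0 LM -> ye; apply: opb_le (opb_nrm _); rewrite /nrm /vnorm -sqrtrM //.
apply: ler_wsqrtr; apply: le_trans (hankel_nrm2 _ L0 LM) _.
by rewrite ler_wpM2l.
Qed.

Lemma lob_conj m n (A : 'M[C]_(m, n)) c : lob A c -> lob (map_mx (@conjc R) A) c.
Proof.
have nc p (x : 'cV[C]_p) : nrm (map_mx (@conjc R) x) = nrm x.
  rewrite /nrm !nrm2_cV; congr Num.sqrt; apply: eq_bigr => i _.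
  by rewrite mxE cabs_conj.
move=> Ac x; rewrite -nc -[nrm (_ *m x)]nc map_mxM.
have -> : map_mx (@conjc R) (map_mx (@conjc R) A) = A.
  by apply/matrixP => i j; rewrite !mxE conjcK.
exact: Ac.
Qed.

Lemma ctr_tr m n (A : 'M[C]_(m, n)) : ctr A^T = map_mx (@conjc R) A.
Proof. by apply/matrixP => i j; rewrite !mxE. Qed.

Definition rowsel_mx m p (f : nat -> nat) : 'M[C]_(p, m) :=
  \matrix_(i, l) ((l : nat) == f i)%:R.

Lemma rowselE m n p (A : 'M[C]_(m, n)) f : rowsel p A f = rowsel_mx m p f *m A.
Proof.
apply/matrixP => i j; rewrite !mxE big_mkcond; apply: eq_bigr => l _.
by rewrite mxE; case: eqP; rewrite ?mul1r ?mul0r.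
Qed.

Lemma opb_rowsel m p (f : nat -> nat) : injective f -> (forall i, (i < p)%N -> (f i < m)%N) ->
  opb (rowsel_mx m p f) 1.
Proof.
move=> fi fm; rewrite -[rowsel_mx m p f]ctrK; apply: opb_ctr => //; apply: opb_ortho.
rewrite /orthonormal_cols ctrK; apply/matrixP => i j; rewrite !mxE.
rewrite (bigD1 (Ordinal (fm i (ltn_ord i)))) //= ctrE !mxE /= eqxx mul1r.
rewrite big1 ?addr0 => [|l li]; first by rewrite (inj_eq fi) val_eqE conjc_nat.
rewrite mxE; case: eqP => [e|_]; last by rewrite mul0r.
by case/eqP: li; exact: val_inj.
Qed.

Lemma rowsel_vander K L (z : 'I_K -> C) :
  rowsel_mx L L.-1 (fun i => i) *m vander z L = vander z L.-1.
Proof.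
rewrite -rowselE; apply/matrixP => i j; rewrite !mxE.
have iL : (i < L)%N by have := ltn_ord i; lia.
rewrite (big_pred1 (Ordinal iL)) ?mxE // => l; exact: val_eqE.
Qed.

Lemma rowsel_vander_shift K L (z : 'I_K -> C) :
  rowsel_mx L L.-1 succn *m vander z L = vander z L.-1 *m diag_mx (\row_k z k).
Proof.
rewrite -rowselE mul_mx_diag; apply/matrixP => i j; rewrite !mxE.
have iL : (i.+1 < L)%N by have := ltn_ord i; lia.
rewrite (big_pred1 (Ordinal iL)) ?mxE ?exprSr // => l; exact: val_eqE.
Qed.

Lemma fmin_le n (f : 'I_n -> R) k : fmin f <= f k.
Proof. exact: bigmin_le. Qed.

Lemma le_fmax n (f : 'I_n -> R) k : f k <= fmax f.
Proof. exact: le_bigmax. Qed.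

Lemma fmin_ge0 n (f : 'I_n -> R) : (forall k, 0 <= f k) -> 0 <= fmin f.
Proof.
by move=> f0; apply/bigmin_geP; split=> [|i _ //]; exact: bigmax_ge_id.
Qed.

End Hankel.

Section Estimates.
Variable R : rcfType.
Local Notation C := R[i].

Lemma hankel_ext L M (x y : nat -> C) : (forall n, x n = y n) ->
  hankel L M x = hankel L M y.
Proof. by move=> xy; apply/matrixP => i j; rewrite !mxE xy. Qed.

Lemma noisy_signal_subspaces m q k (A : 'M[C]_(m, k.+1)) (B : 'M[C]_(q, k.+1)) (D : 'M[C]_k.+1)
    (E : 'M[C]_(m, q)) U s W a b d eps g :
  (k < m)%N -> (k < q)%N -> 0 < a -> 0 < b -> 0 < d -> lob A a -> lob B b -> lob D d ->
  opb E eps -> eps <= g * (a * d * b) -> g < 1 ->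
  is_svd (A *m D *m B^T + E) U s W ->
  (forall (S : 'M[C]_(m, k.+1)) (G : 'M[C]_k.+1), orthonormal_cols S -> A = S *m G ->
     opb (firstcols k.+1 U - S *m (ctr S *m firstcols k.+1 U)) (g / (1 - g))) /\
  (forall (S : 'M[C]_(q, k.+1)) (G : 'M[C]_k.+1), orthonormal_cols S -> map_mx (@conjc R) B = S *m G ->
     opb (firstcols k.+1 W - S *m (ctr S *m firstcols k.+1 W)) (g / (1 - g))).
Proof.
move=> km kq a0 b0 d0 Aa Bb Dd Ee eg g1 Xs.
have q0 : (0 < q)%N by exact: leq_ltn_trans kq.
have e0 : 0 <= eps by exact: opb_ge0 q0 Ee.
have t0 : 0 < a * d * b by rewrite !mulr_gt0.
have sk : a * d * b * (1 - g) <= s k.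
  rewrite mulrBr mulr1 [_ * g]mulrC; apply: le_trans (_ : _ <= a * d * b - eps) _; first by rewrite lerB.
  apply: weyl_lower Xs => //; try exact: ltW.
  by rewrite ctr_tr; exact: lob_conj.
have g1' : 0 < 1 - g by rewrite subr_gt0.
have sk0 : 0 < s k by apply: lt_le_trans sk; rewrite mulr_gt0.
have es : eps <= g / (1 - g) * s k.
  have g0 : 0 <= g by have := le_trans e0 eg; rewrite pmulr_lge0.
  apply: le_trans eg _; rewrite -[leRHS]mulrA ler_wpM2l // ler_pdivlMl //.
  by rewrite [leLHS]mulrC.
split=> S G So SG.
  have Xs' : is_svd (S *m (G *m D *m B^T) + E) U s W by move: Xs; rewrite SG !mulmxA.
  exact: singular_subspace_angle Ee Xs' _ es.
have Xs' : is_svd (S *m (G *m ctr (A *m D)) + ctr E) W s U.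
  by move: (svd_ctr Xs); rewrite ctrD ctrM ctr_tr SG mulmxA.
exact: singular_subspace_angle (opb_ctr e0 Ee) Xs' _ es.
Qed.

Lemma lob_compressed m k (A S T : 'M[C]_(m, k)) (G : 'M[C]_k) a eta :
  orthonormal_cols S -> orthonormal_cols T -> A = S *m G -> 0 < a -> lob A a ->
  opb (T - S *m (ctr S *m T)) eta -> 0 <= eta -> eta < 1 ->
  lob (ctr T *m A) (Num.sqrt (1 - eta ^+ 2) * a).
Proof.
move=> So To AE a0 Aa ang eta0 eta1.
have c0 : 0 < Num.sqrt (1 - eta ^+ 2) by rewrite sqrtr_gt0 subr_gt0 expr_lt1.
rewrite AE mulmxA; apply: lobM; first exact: ltW.
  have -> : ctr T *m S = ctr (ctr S *m T) by rewrite ctrM ctrK.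
  by apply: lob_ctr => //; apply: lob_angle => //; exact: ltW.
by move=> x; rewrite -(nrm_isometry (G *m x) So) mulmxA -AE.
Qed.

Lemma sqrt2_bounds : 7 / 5 <= Num.sqrt (2 : R) <= 3 / 2.
Proof.
have s2 : Num.sqrt (2 : R) ^+ 2 = 2 by rewrite sqr_sqrtr.
by have s0 := sqrtr_ge0 (2 : R); apply/andP; split; nra.
Qed.

Lemma shift_noise_gain (r b g : R) : b != 0 -> 1 - g != 0 -> 1 - (1 + r * b) * g != 0 ->
  (b^-1 - r * (g / (1 - g)))^-1 * (r * (g / (1 - g))) = r * b * g / (1 - (1 + r * b) * g).
Proof.
move=> b0 g0 d0.
have -> : b^-1 - r * (g / (1 - g)) = (1 - (1 + r * b) * g) / (b * (1 - g)).
  by field; rewrite b0 g0.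
by field; rewrite d0 b0 g0.
Qed.

Lemma pencil_small_noise (g : R) : 0 <= g -> g < 3 / 10 ->
  let h := g / (1 - (g / (1 - g)) ^+ 2) in
  h < 1 /\ 2 * h / (1 - h) <=
    g * (2 * Num.sqrt 2 / (1 - g) + (1 + Num.sqrt 2 * g / (1 - g))).
Proof.
move=> g0 g3 h; have /andP[r1 r2] := sqrt2_bounds; set r := Num.sqrt 2 in r1 r2 *.
have p1 : 0 < 1 - g by lra.
have p2 : 0 < 1 - 2 * g by lra.
have p3 : 0 < 1 - 3 * g + 2 * g ^+ 2 - g ^+ 3 by rewrite !exprS expr0; nra.
have hE : h = g * (1 - g) ^+ 2 / (1 - 2 * g).
  rewrite /h; have -> : 1 - (g / (1 - g)) ^+ 2 = (1 - 2 * g) / (1 - g) ^+ 2.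
    by field; rewrite gt_eqF.
  by field; rewrite ?gt_eqF.
have h1 : 1 - h = (1 - 3 * g + 2 * g ^+ 2 - g ^+ 3) / (1 - 2 * g).
  by rewrite hE; field; rewrite ?gt_eqF.
split; first by rewrite -subr_gt0 h1 divr_gt0.
have -> : 2 * h / (1 - h) = g * (2 * (1 - g) ^+ 2 / (1 - 3 * g + 2 * g ^+ 2 - g ^+ 3)).
  by rewrite h1 hE; field; rewrite ?gt_eqF.
rewrite ler_wpM2l // ler_pdivrMr //.
have -> : 2 * r / (1 - g) + (1 + r * g / (1 - g)) = (2 * r + 1 - g + r * g) / (1 - g).
  by field; rewrite ?gt_eqF.
rewrite mulrAC ler_pdivlMr //.
apply: (@le_trans _ _ ((19 / 5 + 2 / 5 * g) * (1 - 3 * g + 2 * g ^+ 2 - g ^+ 3))).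
  rewrite -subr_ge0 (_ : _ - _ = 9 / 5 - 5 * g + g ^+ 2 * (2 / 5 - g - 2 / 5 * g ^+ 2)).
    have g2 : 0 <= g ^+ 2 <= 9 / 100 by rewrite !exprS expr0; apply/andP; split; nra.
    by have /andP[? ?] := g2; apply: addr_ge0; [lra | apply: mulr_ge0; lra].
  by field.
by rewrite ler_wpM2r ?(ltW p3) //; have := ler_wpM2r g0 r1; lra.
Qed.

Lemma pencil_large_noise (g A : R) : 3 / 10 <= g -> g < 1 -> 0 <= A -> A <= 1 ->
  1 <= g / Num.sqrt (1 + A ^+ 2)
       * (2 * Num.sqrt 2 / (1 - g) + (1 + Num.sqrt 2 * g / (1 - g))).
Proof.
move=> g3 g1 A0 A1; have /andP[r1 r2] := sqrt2_bounds.
have A2 : Num.sqrt (1 + A ^+ 2) <= Num.sqrt 2.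
  by apply: ler_wsqrtr; have : A ^+ 2 <= 1; [rewrite expr_le1 | lra].
have A3 : 0 < Num.sqrt (1 + A ^+ 2) by rewrite sqrtr_gt0 ltr_wpDr ?sqr_ge0.
set r := Num.sqrt 2 in r1 r2 A2 *; set t := Num.sqrt _ in A2 A3 *.
have p1 : 0 < 1 - g by lra.
rewrite mulrAC ler_pdivlMr // mul1r; apply: le_trans A2 _.
have -> : 2 * r / (1 - g) + (1 + r * g / (1 - g)) = (2 * r + 1 - g + r * g) / (1 - g).
  by field; rewrite ?gt_eqF.
rewrite mulrA ler_pdivlMr //; nra.
Qed.

Lemma chordal_le (w z : C) A : 0 <= A -> A <= cabs z ->
  chordal (Some w) z <= cabs (w - z) / Num.sqrt (1 + A ^+ 2).
Proof.
move=> A0 Az; rewrite /chordal.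
have p (t : R) : 0 < Num.sqrt (1 + t ^+ 2) by rewrite sqrtr_gt0 ltr_wpDr ?sqr_ge0.
rewrite ler_wpM2l ?cabs_ge0 // lef_pV2 ?posrE ?mulr_gt0 //.
rewrite -[leLHS]mul1r ler_pM ?sqrtr_ge0 //.
  by rewrite -[leLHS]sqrtr1 ler_wsqrtr // lerDl sqr_ge0.
by rewrite ler_wsqrtr // lerD2l; apply: lerXn2r; rewrite ?nnegrE ?cabs_ge0.
Qed.

Lemma chordal_le1 (w : option C) (z : C) : chordal w z <= 1.
Proof.
have p (t : R) : 0 < Num.sqrt (1 + t ^+ 2) by rewrite sqrtr_gt0 ltr_wpDr ?sqr_ge0.
case: w => [w|] /=; rewrite ler_pdivrMr ?mulr_gt0 // mul1r; last first.
  by rewrite -[leLHS]sqrtr1 ler_wsqrtr // lerDl sqr_ge0.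
rewrite -sqrtrM ?addr_ge0 ?sqr_ge0 //.
have wz : cabs (w - z) <= cabs w + cabs z by rewrite -[cabs z]cabsN; exact: ler_cabsD.
rewrite -[leLHS]ger0_norm ?cabs_ge0 // -sqrtr_sqr ler_wsqrtr //.
have := cabs_ge0 w; have := cabs_ge0 z; have := cabs_ge0 (w - z).
set x := cabs (w - z) in wz *; set u := cabs w in wz *; set v := cabs z in wz *.
move=> x0 v0 u0; apply: (@le_trans _ _ ((u + v) ^+ 2)).
  by apply: lerXn2r; rewrite ?nnegrE ?addr_ge0.
have := sqr_ge0 (u * v - 1); rewrite !exprS !expr0; nra.
Qed.

End Estimates.

Theorem theorem1 (R : rcfType) (K N L : nat)
  (z alpha : 'I_K -> R[i]) (e : nat -> R[i]) :
  (1 <= K)%N -> (2 * K <= N)%N -> (K <= L)%N -> (L <= N - K)%N ->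
  injective z ->
  (forall k, 0 < cabs (z k) <= 1) ->
  0 < fmin (fun k => cabs (alpha k)) ->
  let amin := fmin (fun k => cabs (alpha k)) in
  let amax := fmax (fun k => cabs (alpha k)) in
  let x := fun n : nat => \sum_(k < K) alpha k * z k ^+ n in
  let xt := fun n : nat => x n + e n in
  let V := vander z in
  (* Case 1: ESPRIT *)
  ((K < L)%N ->
   forall (U : 'M[R[i]]_L) (s : nat -> R) (W : 'M[R[i]]_((N - L).+1)),
   let Xt := hankel L N xt in
   is_svd Xt U s W ->
   let St : 'M[R[i]]_(L, K) := firstcols K U in
   let Sdn : 'M[R[i]]_(L.-1, K) := rowsel L.-1 St (fun i => i) in
   let Sup : 'M[R[i]]_(L.-1, K) := rowsel L.-1 St (fun i => i.+1) in
   let Phi := pinv Sdn *m Sup in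
   Sdn *m Phi = Sup ->
   let gamma := Num.sqrt (minn L (N - L + 1))%:R * vnorm N e
                / (amin * sigma_min (V L) * sigma_min (V (N - L + 1)%N)) in
   let beta := sigma_max (V L) / sigma_min (V L.-1) in
   gamma < 1 / (1 + Num.sqrt 2 * beta) ->
   forall zh : 'I_K -> R[i], eigvals_mult Phi zh ->
   exists pi : 'S_K, forall k : 'I_K,
     cabs (zh (pi k) - z k) <=
       (2 * K - 1)%:R * Num.sqrt 2 * beta * gamma
       / (1 - (1 + Num.sqrt 2 * beta) * gamma)
       * (1 + kappa (V L)) * kappa (V L))
  /\
  (* Case 2: Matrix Pencil *)
  (forall (U : 'M[R[i]]_L) (s : nat -> R) (W : 'M[R[i]]_((N.-1 - L).+1)),
   let Xt1 := hankel L N.-1 xt in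
   let Xt2 := hankel L N.-1 (fun n => xt n.+1) in
   is_svd Xt1 U s W ->
   let S1 : 'M[R[i]]_(L, K) := firstcols K U in
   let R1 : 'M[R[i]]_((N.-1 - L).+1, K) := firstcols K W in
   let Psi1 := ctr S1 *m Xt1 *m R1 in
   let Psi2 := ctr S1 *m Xt2 *m R1 in
   regular_pair Psi1 Psi2 ->
   let gamma := Num.sqrt (minn L (N - L))%:R * vnorm N e
                / (amin * sigma_min (V L) * sigma_min (V (N - L)%N)) in
   gamma < 1 ->
   let Amin := fmin (fun k => cabs (z k)) in
   forall zh : 'I_K -> option R[i], gen_eigvals_mult Psi1 Psi2 zh ->
   exists pi : 'S_K, forall k : 'I_K,
     chordal (zh (pi k)) (z k) <=
       (2 * K - 1)%:R * gamma / Num.sqrt (1 + Amin ^+ 2)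
       * (2 * Num.sqrt 2 / (1 - gamma) * (amax / amin)
            * kappa (V L) * kappa (V (N - L)%N)
          + (1 + Num.sqrt 2 * gamma / (1 - gamma)))).

Proof.
case: K z alpha => // k z alpha _ KN kL LK zinj zb amin_gt0 amin amax x xt V.
have LN : (L <= N)%N by clear -KN kL LK; lia.
have L0 : (0 < L)%N by exact: leq_ltn_trans kL.
have LN1 : (L <= N.-1)%N by clear -KN kL LK; lia.
have NE : N = N.-1.+1 by clear -KN; lia.
have kq : (k.+1 <= (N - L).+1)%N by clear -KN kL LK; lia.
have kq1 : (k.+1 <= (N.-1 - L).+1)%N by clear -KN kL LK; lia.
have NLE : (N - L)%N = (N.-1 - L).+1 by clear -KN kL LK; lia.
have kK : (k.+1 <= 2 * k.+1 - 1)%N by clear; lia.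
have z1 j : cabs (z j) <= 1 by have /andP[] := zb j.
have Vinj M : (k.+1 <= M)%N -> forall y : 'cV[R[i]]_k.+1, V M *m y = 0 -> y = 0.
  by move=> kM; exact: vander_inj.
have Vlob M : (k.+1 <= M)%N -> lob (V M) (sigma_min (V M)).
  by move=> kM; exact: lob_sigma_min kM (Vinj _ kM).
have Vopb M : (k.+1 <= M)%N -> opb (V M) (sigma_max (V M)).
  by move=> kM; exact: opb_sigma_max kM (Vinj _ kM).
have Vpos M : (k.+1 <= M)%N -> 0 < sigma_min (V M).
  by move=> kM; exact: sigma_min_gt0 kM (Vinj _ kM).
have Vkap M : (k.+1 <= M)%N -> sigma_min (V M) <= sigma_max (V M).
  by move=> kM; exact: sigma_min_le_max kM (Vinj _ kM).
have alob : lob (diag_mx (\row_j alpha j)) amin.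
  by apply: lob_diag => [j|]; [exact: fmin_le | exact: ltW].
split.
- move=> kL' U s W Xt Xs St Sdn Sup Phi PhiE; rewrite addn1.
  set sQ := sigma_min (V (N - L).+1); set sL := sigma_min (V L); set r := Num.sqrt 2.
  move=> gamma beta gam_lt w Phiw.
  have kd : (k.+1 <= L.-1)%N by rewrite -ltnS prednK.
  have sQ0 : 0 < sQ by exact: Vpos.
  have sL0 : 0 < sL by exact: Vpos.
  have sM0 : 0 < sigma_max (V L) by apply: lt_le_trans (Vkap _ kL).
  have sd0 : 0 < sigma_min (V L.-1) by exact: Vpos.
  pose eps := Num.sqrt (minn L (N - L).+1)%:R * vnorm N e.
  have eps0 : 0 <= eps by rewrite mulr_ge0 ?sqrtr_ge0.
  have t0 : 0 < sL * amin * sQ by rewrite !mulr_gt0.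
  have epsE : eps = gamma * (sL * amin * sQ).
    by rewrite /gamma -/eps [amin * sL]mulrC divfK // gt_eqF.
  clearbody gamma.
  have gam0 : 0 <= gamma by rewrite -(pmulr_lge0 _ t0) -epsE.
  set Jd := rowsel_mx R L L.-1 (fun i => i); set Ju := rowsel_mx R L L.-1 succn.
  have Jd1 : opb Jd 1 by apply: opb_rowsel => // i iL; exact: leq_trans iL (leq_pred _).
  have Ju1 : opb Ju 1 by apply: opb_rowsel => [? ? []|i iL] //; rewrite -(prednK L0).
  have JdV : Jd *m V L = V L.-1 by exact: rowsel_vander.
  have beta1 : 1 <= beta.
    rewrite ler_pdivlMr // mul1r.
    have v0 : 0 < nrm (const_mx 1 : 'cV[R[i]]_k.+1).
      by rewrite nrm_gt0; apply/eqP => /matrixP /(_ 0 0) /eqP; rewrite !mxE oner_eq0.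
    rewrite -(ler_pM2r v0); apply: le_trans (Vlob _ kd _) _.
    rewrite -JdV -mulmxA; apply: le_trans (Jd1 _) _.
    by rewrite mul1r; exact: Vopb.
  have /andP[] := sqrt2_bounds R; rewrite -/r => r1 r2.
  have r0 : 0 < r by lra.
  have beta0 : 0 < beta by exact: lt_le_trans ltr01 beta1.
  have den : 0 < 1 - (1 + r * beta) * gamma.
    move: gam_lt; rewrite ltr_pdivlMr; last by rewrite addr_gt0 // mulr_gt0.
    by rewrite mulrC => ?; rewrite subr_gt0.
  have rb : 7 / 5 <= r * beta by apply: le_trans r1 _; rewrite ler_peMr // ltW.
  have rbg : 7 / 5 * gamma <= r * beta * gamma by rewrite ler_wpM2r.
  have g1 : 0 < 1 - gamma by lra.
  have Xs' : is_svd (V L *m diag_mx (\row_j alpha j) *m (V (N - L).+1)^T + hankel L N e) U s W.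
    by rewrite -hankel_vander -hankelD.
  have Ee : opb (hankel L N e) eps by exact: opb_hankel.
  have eps_le : eps <= gamma * (sL * amin * sQ) by rewrite epsE.
  have gamma1 : gamma < 1 by rewrite -subr_gt0.
  have [ang _] := noisy_signal_subspaces kL kq sL0 sQ0 amin_gt0
    (Vlob _ kL) (Vlob _ kq) alob Ee eps_le gamma1 Xs'.
  have [S [G [So VSG]]] := orthonormal_factor kL (Vinj _ kL).
  have {}ang := ang S G So VSG.
  have [[Uo Wo] _ _ _ _] := Xs.
  have To : orthonormal_cols St by exact: firstcols_ortho.
  have eta0 : 0 <= gamma / (1 - gamma) by rewrite divr_ge0 // ltW.
  have eta1 : gamma / (1 - gamma) < 1 by rewrite ltr_pdivrMr // mul1r; lra.
  have [Q Qo Td] := aligned_basis So To ang eta0 eta1.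
  have small : r * (gamma / (1 - gamma)) * (sigma_max (V L) / sigma_min (V L.-1)) < 1.
    rewrite -/beta mulrA -[_ * beta]mulrA [_^-1 * _]mulrC mulrA ltr_pdivrMr // mul1r.
    by rewrite mulrAC; lra.
  have shiftE : Ju *m V L = Jd *m V L *m diag_mx (\row_j z j).
    by rewrite JdV; exact: rowsel_vander_shift.
  have Vd : lob (Jd *m V L) (sigma_min (V L.-1)) by rewrite JdV; exact: Vlob.
  have PhiE' : Jd *m St *m Phi = Ju *m St by rewrite -!rowselE.
  have [p pP] := shift_perturbation z1 Jd1 Ju1 sL0 sM0 sd0 (Vlob _ kL) (Vopb _ kL) Vd shiftE
    So VSG Qo Td small PhiE' Phiw.
  exists p => j; apply: le_trans (pP j) _.
  have kap0 : 0 <= kappa (V L) by rewrite divr_ge0 // ltW.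
  have -> : sigma_min (V L.-1) / sigma_max (V L) = beta^-1 by rewrite invf_div.
  rewrite -/r -/(kappa (V L)).
  clearbody beta; move: (kappa _) kap0 => kap kap0.
  rewrite [X in _ * (_ * X)]mulrA shift_noise_gain ?gt_eqF //.
  have -> : (2 * k.+1 - 1)%:R * r * beta * gamma / (1 - (1 + r * beta) * gamma)
      * (1 + kap) * kap
    = (2 * k.+1 - 1)%:R * (kap
      * (r * beta * gamma / (1 - (1 + r * beta) * gamma) * (1 + kap))).
    by move: (2 * k.+1 - 1)%:R ((1 - (1 + r * beta) * gamma)^-1) => u v; ring.
  apply: ler_wpM2r; last by rewrite ler_nat.
  rewrite mulr_ge0 // mulr_ge0 ?addr_ge0 // divr_ge0 ?(ltW den) // mulr_ge0 //.
  by rewrite ltW // mulr_gt0.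
- move=> U s W Xt1 Xt2 Xs S1 R1 Psi1 Psi2 _.
  rewrite NLE.
  set q := (N.-1 - L).+1 in W Xs R1 Psi1 Psi2 kq1 *.
  set sQ := sigma_min (V q); set sL := sigma_min (V L); set r := Num.sqrt 2.
  move=> gamma gamma1 Amin zh zhE.
  have sQ0 : 0 < sQ by exact: Vpos.
  have sL0 : 0 < sL by exact: Vpos.
  have t0 : 0 < sL * amin * sQ by rewrite !mulr_gt0.
  pose eps := Num.sqrt (minn L q)%:R * vnorm N e.
  have eps0 : 0 <= eps by rewrite mulr_ge0 ?sqrtr_ge0.
  have epsE : eps = gamma * (sL * amin * sQ).
    by rewrite /gamma -/eps [amin * sL]mulrC divfK // gt_eqF.
  clearbody gamma.
  have eps_le : eps <= gamma * (sL * amin * sQ) by rewrite epsE.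
  have gam0 : 0 <= gamma by rewrite -(pmulr_lge0 _ t0) -epsE.
  have kap1 M : (k.+1 <= M)%N -> 1 <= kappa (V M).
    by move=> kM; rewrite ler_pdivlMr ?mul1r ?Vkap ?Vpos.
  have ratio1 : 1 <= amax / amin.
    rewrite ler_pdivlMr // mul1r; apply: le_trans (fmin_le _ ord0) _.
    exact: (le_fmax (fun j => cabs (alpha j)) ord0).
  have Amin0 : 0 <= Amin by apply: fmin_ge0 => j; exact: cabs_ge0.
  have Amin_le j : Amin <= cabs (z j) by exact: (fmin_le (fun j => cabs (z j))).
  have Amin1 : Amin <= 1 by exact: le_trans (Amin_le ord0) (z1 _).
  have wA : 0 < Num.sqrt (1 + Amin ^+ 2) by rewrite sqrtr_gt0 ltr_wpDr ?sqr_ge0.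
  have g1 : 0 < 1 - gamma by rewrite subr_gt0.
  have r0 : 0 <= r by exact: sqrtr_ge0.
  pose bnd := 2 * r / (1 - gamma) + (1 + r * gamma / (1 - gamma)).
  have bnd0 : 0 <= bnd.
    by rewrite /bnd !addr_ge0 ?divr_ge0 ?mulr_ge0 ?(ltW g1).
  suff : exists pi : 'S_k.+1, forall j, chordal (zh (pi j)) (z j) <=
      (2 * k.+1 - 1)%:R * (gamma / Num.sqrt (1 + Amin ^+ 2) * bnd).
    move=> [p pP]; exists p => j; apply: le_trans (pP j) _.
    rewrite -[X in _ <= X * _]mulrA -[leRHS]mulrA ler_wpM2l //.
    rewrite ler_wpM2l ?divr_ge0 ?(ltW wA) // /bnd lerD2r.
    rewrite -[leRHS]mulrA -[leRHS]mulrA ler_peMr ?divr_ge0 ?mulr_ge0 ?(ltW g1) //.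
    by apply: mulr_ege1 => //; apply: mulr_ege1; exact: kap1.
  have c1 : 1 <= (2 * k.+1 - 1)%:R :> R by rewrite ler1n; exact: leq_trans kK.
  have [g3|g3] := leP (3 / 10) gamma.
    exists 1%g => j; apply: le_trans (chordal_le1 _ _) _.
    apply: mulr_ege1 c1 _; exact: pencil_large_noise.
  have [h1 h2] := pencil_small_noise gam0 g3.
  set eta := gamma / (1 - gamma) in h1 h2.
  have eta0 : 0 <= eta by rewrite divr_ge0 // ltW.
  have eta1 : eta < 1 by rewrite ltr_pdivrMr // mul1r; lra.
  have c2 : 0 < 1 - eta ^+ 2 by rewrite subr_gt0 expr_lt1.
  pose E1 := hankel L N.-1 e; pose E2 := hankel L N.-1 (fun n => e n.+1).
  set D := diag_mx (\row_j alpha j) in alob; set Z := diag_mx (\row_j z j).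
  have X1E : Xt1 = V L *m D *m (V q)^T + E1 by rewrite -hankel_vander -hankelD.
  have X2E : Xt2 = V L *m D *m Z *m (V q)^T + E2.
    have -> : V L *m D *m Z = V L *m diag_mx (\row_j (alpha j * z j)).
      by rewrite -mulmxA mulmx_diag; congr (_ *m diag_mx _); apply/rowP => j; rewrite !mxE.
    rewrite -hankel_vander -hankelD; apply: hankel_ext => n; congr (_ + _).
    by apply: eq_bigr => j _; rewrite exprS mulrA.
  have E1e : opb E1 eps.
    apply: opb_hankel => //.
    rewrite -[leRHS](big_mkord predT (fun n => cabs (e n) ^+ 2)).
    by rewrite [X in index_iota _ X]NE big_nat_recr //= big_mkord lerDl sqr_ge0.
  have E2e : opb E2 eps.
    apply: opb_hankel => //.
    rewrite -[leRHS](big_mkord predT (fun n => cabs (e n) ^+ 2)).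
    by rewrite [X in index_iota _ X]NE big_nat_recl //= big_mkord lerDr sqr_ge0.
  have Xs1 : is_svd (V L *m D *m (V q)^T + E1) U s W by rewrite -X1E.
  have [angU angW] := noisy_signal_subspaces kL kq1 sL0 sQ0 amin_gt0
    (Vlob _ kL) (Vlob _ kq1) alob E1e eps_le gamma1 Xs1.
  have [[Uo Wo] _ _ _ _] := Xs.
  have So1 : orthonormal_cols S1 by exact: firstcols_ortho.
  have Ro1 : orthonormal_cols R1 by exact: firstcols_ortho.
  have [S [G [So VSG]]] := orthonormal_factor kL (Vinj _ kL).
  have cVlob := lob_conj (Vlob _ kq1).
  have cVinj (y : 'cV[R[i]]_k.+1) : map_mx (@conjc R) (V q) *m y = 0 -> y = 0.
    move=> Vy; have := cVlob y; rewrite Vy nrm0 pmulr_rle0 ?Vpos // => y0.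
    by apply/eqP; rewrite -nrm_eq0 eq_le y0 nrm_ge0.
  have [S' [G' [So' VSG']]] := orthonormal_factor kq1 cVinj.
  pose c := Num.sqrt (1 - eta ^+ 2).
  have c0 : 0 < c by rewrite sqrtr_gt0.
  have cc : c * c = 1 - eta ^+ 2 by rewrite -expr2 sqr_sqrtr // ltW.
  pose A := ctr S1 *m V L; pose B := (V q)^T *m R1.
  have Al : lob A (c * sL).
    exact: lob_compressed So So1 VSG sL0 (Vlob _ kL) (angU _ _ So VSG) eta0 eta1.
  have Bl : lob B (c * sQ).
    have -> : B = ctr (ctr R1 *m map_mx (@conjc R) (V q)) by rewrite ctrM ctrK -ctr_tr ctrK.
    apply: lob_ctr; first by rewrite mulr_gt0.
    exact: lob_compressed So' Ro1 VSG' sQ0 cVlob (angW _ _ So' VSG') eta0 eta1.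
  pose N1 := ctr S1 *m E1 *m R1; pose N2 := ctr S1 *m E2 *m R1.
  have comp_opb E : opb E eps -> opb (ctr S1 *m E *m R1) eps.
    move=> Ee; have -> : eps = 1 * eps * 1 by rewrite mul1r mulr1.
    apply: opbM; rewrite ?mul1r //; last exact: opb_ortho.
    by rewrite -[eps]mul1r; apply: opbM => //; apply: opb_ctr => //; exact: opb_ortho.
  have P1E : Psi1 = A *m D *m B + N1.
    by rewrite /Psi1 X1E mulmxDr mulmxDl /A /B /N1 !mulmxA.
  have P2E : Psi2 = A *m D *m Z *m B + N2.
    by rewrite /Psi2 X2E mulmxDr mulmxDl /A /B /N2 !mulmxA.
  have eps_h : eps <= gamma / (1 - eta ^+ 2) * (c * sL * amin * (c * sQ)).
    have -> : c * sL * amin * (c * sQ) = (c * c) * (sL * amin * sQ) by ring.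
    by rewrite cc mulrA divfK ?gt_eqF.
  move: zhE; rewrite P1E P2E => zhE.
  have [p pP] := pencil_perturbation z1 (mulr_gt0 c0 sL0) (mulr_gt0 c0 sQ0) amin_gt0
    Al Bl alob (comp_opb _ E1e) (comp_opb _ E2e) eps_h h1 zhE.
  exists p => j; have [w -> wz] := pP j.
  apply: le_trans (chordal_le _ Amin0 (Amin_le j)) _.
  rewrite [gamma / _ * bnd]mulrAC [leRHS]mulrA ler_pM2r ?invr_gt0 //; apply: le_trans wz _.
  apply: ler_pM => //; last by rewrite ler_nat.
  by rewrite divr_ge0 ?subr_ge0 ?(ltW h1) // mulr_ge0 // divr_ge0 // ltW.
Qed.
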